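(* The spectral measure $\nu_{\rho_2}$ (over $\chi_{\rho_2}(\mathbb{T}^2)=[-1,3]$) for the graph $\mathcal{G}^{D_4^{(2)}}_{\rho_2}$ for $SO(4)$ is given by $$\mathrm{d}\nu_{\rho_2}(y)=\frac{1}{2\pi}\,\frac{\sqrt{3-y}}{\sqrt{y+1}}\,\mathrm{d}y.$$
   Context: Let $P_+=\{\lambda\in\mathbb{Z}^2:\lambda_1\ge|\lambda_2|\}$. For $\lambda\in\mathbb{Z}^2$ put $S_\lambda=\omega_1^{\lambda_1}\omega_2^{\lambda_2}+\omega_1^{-\lambda_1}\omega_2^{-\lambda_2}-\omega_1^{\lambda_2}\omega_2^{\lambda_1}-\omega_1^{-\lambda_2}\omega_2^{-\lambda_1}$, and for $\lambda\in P_+$ let $\chi_\lambda=S_{\lambda+(1,0)}/S_{(1,0)}$ (the irreducible characters of $SO(4)$ on its maximal torus $\mathbb{T}^2$; its Weyl group is $D_4^{(2)}=\langle -I,\begin{pmatrix}0&1\\1&0\end{pmatrix}\rangle$). Put $\rho_2=(1,1)$, so $\chi_{\rho_2}=1+\omega_1\omega_2+\omega_1^{-1}\omega_2^{-1}$. The graph $\mathcal{G}^{D_4^{(2)}}_{\rho_2}$ has vertex set $P_+$ and $m_{\mu\nu}$ edges from $\mu$ to $\nu$, where $\chi_{\rho_2}\chi_\mu=\sum_\nu m_{\mu\nu}\chi_\nu$; its adjacency operator $\Delta_{\rho_2}$ on $\ell^2(P_+)$ is self-adjoint. The distinguished vertex is $\ast=(0,0)$. The spectral measure $\nu_{\rho_2}$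 is the unique compactly supported probability measure with $\langle\Delta_{\rho_2}^m\delta_\ast,\delta_\ast\rangle=\int t^m\,\mathrm{d}\nu_{\rho_2}(t)$ for all integers $m\ge0$. *)

(* Defs.v *)
From HB Require Import structures.
From mathcomp Require Import all_boot all_order all_algebra finmap.
From mathcomp Require Import complex.
From mathcomp Require Import all_classical all_reals all_analysis.
From mathcomp.analysis.showcase Require Import summability.

Set Implicit Arguments.
Unset Strict Implicit.
Unset Printing Implicit Defensive.

Import Order.TTheory GRing.Theory Num.Theory.
Import numFieldNormedType.Exports.

Local Open Scope classical_set_scope.
Local Open Scope ring_scope.

(* Naming R[i] at type numClosedFieldType gives its elements the usual norm and
   topology, which the bare type R[i] does not carry. *)
Definition Cplx (R : realType) : numClosedFieldType := R[i].

(** * Characters of SO(4) on its maximal torus *)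

Notation Pplus := {l : int * int | `|l.2| <= l.1}.

Lemma star_subproof : `|(0 : int, 0 : int).2| <= (0 : int, 0 : int).1.
Proof. by []. Qed.

Lemma rho2_subproof : `|(1 : int, 1 : int).2| <= (1 : int, 1 : int).1.
Proof. by []. Qed.

Definition star : Pplus := exist _ (0, 0) star_subproof.

Definition rho2 : Pplus := exist _ (1, 1) rho2_subproof.

Definition torus2 (R : realType) : set (Cplx R * Cplx R) :=
  [set w | `|w.1| = 1 /\ `|w.2| = 1].

Definition altS (R : realType) (l : int * int) (w : Cplx R * Cplx R) : Cplx R :=
  w.1 ^ l.1 * w.2 ^ l.2 + w.1 ^ (- l.1) * w.2 ^ (- l.2)
  - w.1 ^ l.2 * w.2 ^ l.1 - w.1 ^ (- l.2) * w.2 ^ (- l.1).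

Definition torus2_reg (R : realType) : set (Cplx R * Cplx R) :=
  [set w | torus2 w /\ altS (1, 0) w != 0].

(* The quotient S_(l + (1,0)) / S_(1,0) is a Laurent polynomial; as a function
   on the torus it is the continuous extension of the pointwise quotient from
   the dense set where the denominator does not vanish. *)
Definition chi (R : realType) (l : Pplus) (w : Cplx R * Cplx R) : Cplx R :=
  lim ((altS (val l + (1, 0)) z / altS (1, 0) z)
         @[z --> within (@torus2_reg R) (nbhs w)]).

(** * Spectral measure of a graph *)

Section Ell2.
Variables (R : realType) (V : choiceType).

Definition square_summable (f : V -> Cplx R) : Prop :=
  (\esum_(v in [set: V]) (complex.Re (f v) ^+ 2 + complex.Im (f v) ^+ 2)%:E < +oo)%E.

Record ell2 := Ell2 {
  ell2_fun :> V -> Cplx R;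
  ell2P : square_summable ell2_fun }.

(* [sum] is the unconditional sum, i.e. the limit of the finite partial sums
   along the directed set of finite subsets of V. *)
Definition ell2_inner (f g : ell2) : Cplx R :=
  sum (fun v => f v * (g v)^* ).

Lemma square_summable0 : square_summable (fun=> 0).
Proof. by rewrite /square_summable esum1 ?ltry// => v _; rewrite /= expr0n addr0. Qed.

Definition ell2_0 : ell2 := Ell2 square_summable0.

Lemma square_summable_delta (v : V) :
  square_summable (fun w => (w == v)%:R).
Proof.
rewrite /square_summable.
rewrite [X in (X < _)%E](_ : _ = (\esum_(w in [set v]) 1%:E)%E).
  by rewrite esum_set1 ?ltry// lee_fin ler01.
rewrite [RHS]esum_mkcond; apply: eq_esum => w _.
have [->|wv] := eqVneq w v.
  by rewrite mem_set//= expr1n expr0n addr0.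
by rewrite memNset/= ?expr0n ?addr0//; exact/eqP.
Qed.

Definition ell2_delta (v : V) : ell2 := Ell2 (square_summable_delta v).

(* A graph on V is given by the number m v w of edges from v to w, with
   finitely many edges leaving each vertex. *)
Definition adjacency_fun (m : V -> V -> nat) (f : V -> Cplx R) (v : V) : Cplx R :=
  \sum_(w \in [set: V]) (m v w)%:R * f w.

(* When in- and out-degrees are bounded, as for the graphs below, adjacency_fun
   maps square-summable functions to square-summable functions, so the second
   branch is never taken. *)
Definition adjacency_op (m : V -> V -> nat) (f : ell2) : ell2 :=
  match pselect (square_summable (adjacency_fun m f)) with
  | left mf => Ell2 mf
  | right _ => ell2_0
  end.

Definition is_spectral_measure (m : V -> V -> nat) (v : V)
    (nu : probability (measurableTypeR R) R) : Prop :=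
  (exists K : set R, compact K /\ nu (~` K) = 0%E) /\
  forall k : nat,
    ell2_inner (iter k (adjacency_op m) (ell2_delta v)) (ell2_delta v)
    = (\int[nu]_t (t ^+ k))%:C%C.

End Ell2.

(** * The graph of a character *)

Section Graph.
Variable (R : realType).

Definition is_multiplicity (r : Pplus) (m : Pplus -> Pplus -> nat) : Prop :=
  forall mu : Pplus,
    finite_set [set nu | m mu nu != 0%N] /\
    forall w : Cplx R * Cplx R, torus2 w ->
      chi r w * chi mu w = \sum_(nu \in [set: Pplus]) (m mu nu)%:R * chi nu w.

(* The characters are linearly independent, so is_multiplicity r has at most
   one solution. *)
Definition graphD42 (r : Pplus) : Pplus -> Pplus -> nat :=
  xget (fun _ _ => 0%N) [set m | is_multiplicity r m].

End Graph.

(* Main.v *)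
Require Import Defs.
From HB Require Import structures.
From mathcomp Require Import all_boot all_order all_algebra finmap.
From mathcomp Require Import complex.
From mathcomp Require Import all_classical all_reals all_analysis.
From mathcomp Require Import measurable_realfun.
From mathcomp Require Import zify ring lra.

Set Implicit Arguments.
Unset Strict Implicit.
Unset Printing Implicit Defensive.

Import Order.TTheory GRing.Theory Num.Theory.
Import numFieldNormedType.Exports.
Local Open Scope classical_set_scope.
Local Open Scope ring_scope.

(* In the coordinates w.1 = s t, w.2 = s / t the character of highest weight l
   is the product of two SU(2) characters, V_(l.1 + l.2) at s and V_(l.1 - l.2)
   at t, and rho2 is V_2 at s.  By the Clebsch-Gordan rule the component of the
   vertex (0, 0) in the graph is the half-line of the vertices (j, j), with a
   loop at each of them but (0, 0).  Counting walks on it by the orthogonality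
   of the functions cos (j x) - cos ((j + 1) x) gives the moments
   1/pi int_0^pi (1 + 2 cos x)^k (1 - cos x) dx, which the substitution
   y = 1 + 2 cos x turns into those of the density.  A compactly supported
   probability measure is determined by its moments, because indicators of rays
   are bounded pointwise limits of polynomials on a compact interval. *)

(** * Characters of SU(2) and SO(4) *)

(** Two of the definitions cannot be computed with directly. [chi] is a limit of quotients, so
    regular points have to accumulate at every point of the torus, and the quotient has to agree
    there with a Laurent polynomial, [so4_char]. [graphD42] is picked by [xget], so its edges are
    known only once the expansion of a product into characters is shown to be unique. On the
    analytic side the density is unbounded at -1, so the change of variables is made on compact
    subintervals that exhaust the half-open one. *)

Section SU2Characters.
Variable F : fieldType.
Implicit Types (s t : F) (l : int * int) (z : F * F).

(** A sum over the weights n, n - 2, ..., -n rather than a quotient, so that it makes sense at s = 1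
    and s = -1 too. *)
Definition su2_char (n : nat) s : F := \sum_(i < n.+1) s ^ (n%:Z - 2 * i%:Z).

(** The Weyl character formula for SU(2) with its denominator cleared: the product telescopes. *)
Lemma mulr_su2_char n s : s != 0 ->
  (s - s^-1) * su2_char n s = s ^ (n.+1%:Z) - s ^ (- n.+1%:Z).
Proof.
move=> s0; rewrite /su2_char mulr_sumr.
pose f i := - s ^ (n.+1%:Z - 2 * i%:Z).
transitivity (\sum_(i < n.+1) (f i.+1 - f i)).
  apply: eq_bigr => i _; rewrite mulrBl /f opprK addrC; congr (_ + _).
    rewrite -{2}(expr1z s) -{1}exprN1 -expfzDr//.
    by congr (- (_ ^ _)); lia.
  by rewrite -{1}(expr1z s) -expfzDr//; congr (_ ^ _); lia.
rewrite -(big_mkord xpredT (fun i => f i.+1 - f i)) telescope_sumr// /f opprK.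
by rewrite addrC; congr (_ ^ _ - _ ^ _); lia.
Qed.

Lemma su2_char0 s : su2_char 0 s = 1.
Proof. by rewrite /su2_char big_ord1. Qed.

Lemma su2_char2 s : su2_char 2 s = s ^ 2 + 1 + s ^ (- 2%:Z).
Proof.
rewrite /su2_char !big_ord_recr big_ord0/= add0r -(expr0z s).
by congr (_ ^ _ + _ ^ _ + _ ^ _).
Qed.

(** Clebsch-Gordan by comparing strips of weights: shifting V_n by 2 misses the two lowest weights
    of V_(n+2), and for n > 0 shifting it by -2 returns them beside V_(n-2). *)
Lemma su2_char2M n s : s != 0 ->
  su2_char 2 s * su2_char n s = su2_char n.+2 s + (0 < n)%:R * su2_char n s
    + (if n is m.+2 then su2_char m s else 0).
Proof.
move=> s0.
have sl : s ^ 2 * su2_char n s = su2_char n.+2 s - s ^ (- n%:Z) - s ^ (- n.+2%:Z).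
  suff -> : su2_char n.+2 s = s ^ 2 * su2_char n s + s ^ (- n%:Z) + s ^ (- n.+2%:Z).
    by ring.
  rewrite [LHS]/su2_char !big_ord_recr/=; congr (_ + _ ^ _ + _ ^ _); [|lia|lia].
  rewrite /su2_char big_ord_recr/= mulrDr mulr_sumr -expfzDr//; congr (_ + _ ^ _); last by lia.
  by apply: eq_bigr => i _; rewrite -expfzDr//; congr (_ ^ _); lia.
(* For n = 0 the shifted strip is the single weight -2 and the weight -n is not returned; this is
   why V_0 carries no loop. *)
have sr : s ^ (- 2%:Z) * su2_char n s = (if n is m.+2 then su2_char m s else 0)
    + (0 < n)%:R * s ^ (- n%:Z) + s ^ (- n.+2%:Z).
  case: n {sl} => [|[|m]].
  - by rewrite su2_char0 mulr1 mul0r !add0r.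
  - rewrite /su2_char !big_ord_recl big_ord0 addr0 /= mul1r add0r addr0 mulrDr -!expfzDr//.
  - rewrite /= mul1r {1}/su2_char !big_ord_recr/= !mulrDr -!expfzDr// mulr_sumr.
    congr (_ + _ ^ _ + _ ^ _); [|lia|lia].
    rewrite /su2_char big_ord_recr/=; congr (_ + _ ^ _); last by lia.
    by apply: eq_bigr => i _; rewrite -expfzDr//; congr (_ ^ _); lia.
rewrite su2_char2 !mulrDl mul1r sl sr.
case: n {sl sr} => [|n]; last by rewrite /= !mul1r; ring.
by rewrite /= !mul0r su2_char0 oppr0 expr0z; ring.
Qed.

(* In the coordinates z.1 = s t, z.2 = s / t this is the product of the SU(2)
   characters of highest weights l.1 + l.2 and l.1 - l.2 at s and t. *)
Definition so4_char l z : F :=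
  \sum_(i < `|l.1 + l.2|.+1) \sum_(j < `|l.1 - l.2|.+1)
     z.1 ^ (l.1 - i%:Z - j%:Z) * z.2 ^ (l.2 - i%:Z + j%:Z).

Lemma so4_charE l s t : `|l.2| <= l.1 -> s != 0 -> t != 0 ->
  so4_char l (s * t, s / t) =
    su2_char `|l.1 + l.2| s * su2_char `|l.1 - l.2| t.
Proof.
move=> ll s0 t0; rewrite /so4_char /su2_char big_distrlr/=.
apply: eq_bigr => i _; apply: eq_bigr => j _.
rewrite !expfzMl exprz_inv mulrACA -!expfzDr//.
by congr (_ ^ _ * _ ^ _); lia.
Qed.

End SU2Characters.

(** The pair (s, t) is a lift to the double cover SU(2) x SU(2) of SO(4), on complexified tori;
    either square root would do. *)
Lemma torus_coordinates (C : numClosedFieldType) (z1 z2 : C) :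
  z1 != 0 -> z2 != 0 ->
  exists s t, [/\ s != 0, t != 0, z1 = s * t & z2 = s / t].
Proof.
move=> z10 z20; have s0 : sqrtC (z1 * z2) != 0 by rewrite sqrtC_eq0 mulf_neq0.
exists (sqrtC (z1 * z2)), (z1 / sqrtC (z1 * z2)); split => //.
- by rewrite mulf_neq0// invr_eq0.
- by rewrite mulrC divfK.
- by rewrite invf_div mulrA -expr2 sqrtCK mulrAC divff// mul1r.
Qed.

Section SO4Characters.
Variable C : numClosedFieldType.
Implicit Types (l : int * int) (z : C * C).

(** Convertible to [altS] at [Cplx R]; the general field keeps the topology of [R[i]] out of the
    algebra. *)
Definition so4_alt l z : C :=
  z.1 ^ l.1 * z.2 ^ l.2 + z.1 ^ (- l.1) * z.2 ^ (- l.2)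
  - z.1 ^ l.2 * z.2 ^ l.1 - z.1 ^ (- l.2) * z.2 ^ (- l.1).

(** The Weyl group element -I inverts both s and t, and the swap inverts t alone, so the alternating
    sum splits into one for each SU(2) factor. *)
Lemma so4_altE l (s t : C) : s != 0 -> t != 0 ->
  so4_alt l (s * t, s / t) =
    (s ^ (l.1 + l.2) - s ^ (- (l.1 + l.2))) *
    (t ^ (l.1 - l.2) - t ^ (- (l.1 - l.2))).
Proof.
move=> s0 t0; rewrite /so4_alt/=.
have E a b : (s * t) ^ a * (s / t) ^ b = s ^ (a + b) * t ^ (a - b).
  by rewrite !expfzMl exprz_inv mulrACA -!expfzDr.
rewrite !E mulrBl !mulrBr.
rewrite (_ : - l.1 + - l.2 = - (l.1 + l.2)); last by lia.
rewrite (_ : - l.1 - - l.2 = - (l.1 - l.2)); last by lia.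
rewrite (_ : l.2 + l.1 = l.1 + l.2); last by lia.
rewrite (_ : l.2 - l.1 = - (l.1 - l.2)); last by lia.
rewrite (_ : - l.2 + - l.1 = - (l.1 + l.2)); last by lia.
rewrite (_ : - l.2 - - l.1 = l.1 - l.2); last by lia.
by ring.
Qed.

(** With the denominator cleared the Weyl formula also holds at singular points. It serves to
    identify [chi], and later to turn relations between characters into relations between
    alternating sums. *)
Lemma so4_alt_char l z : `|l.2| <= l.1 -> z.1 != 0 -> z.2 != 0 ->
  so4_alt (1, 0) z * so4_char l z = so4_alt (l + (1, 0)) z.
Proof.
case: z => z1 z2 /= ll z10 z20.
have [s [t [s0 t0 -> ->]]] := torus_coordinates z10 z20.
rewrite so4_charE// !so4_altE//= mulrACA addr0 subr0 expr1z exprN1.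
rewrite -[X in (s - X)]exprN1.
rewrite !mulr_su2_char//; congr ((_ ^ _ - _ ^ _) * (_ ^ _ - _ ^ _)); lia.
Qed.

(** The factor at t is untouched, and changing l.1 + l.2 by 2 or -2 with l.1 - l.2 fixed moves l by
    (1, 1) or -(1, 1). *)
Lemma so4_char_rho2M l z : `|l.2| <= l.1 -> z.1 != 0 -> z.2 != 0 ->
  so4_char (1, 1) z * so4_char l z =
    so4_char (l + (1, 1)) z + (0 < l.1 + l.2)%R%:R * so4_char l z
    + (if `|(l - (1, 1)).2| <= (l - (1, 1)).1 then so4_char (l - (1, 1)) z else 0).
Proof.
case: z => z1 z2 /= ll z10 z20.
have [s [t [s0 t0 -> ->]]] := torus_coordinates z10 z20.
rewrite (so4_charE (l := (1, 1)))// (so4_charE (l := l))//.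
rewrite (so4_charE (l := l + (1, 1)))//=; last by lia.
rewrite su2_char0 mulr1 mulrA su2_char2M// !mulrDl.
rewrite (_ : absz (l.1 + 1 + (l.2 + 1)) = (absz (l.1 + l.2)).+2); last by lia.
rewrite (_ : l.1 + 1 - (l.2 + 1) = l.1 - l.2); last by lia.
rewrite (_ : (0 < l.1 + l.2) = (0 < absz (l.1 + l.2)%R)%N) -?mulrA; last by lia.
(* Given [ll], the condition says l.1 + l.2 >= 2, which is when Clebsch-Gordan has its third
   term. *)
congr (_ + _); case: ifPn => h.
  rewrite so4_charE//= (_ : l.1 - 1 - (l.2 - 1) = l.1 - l.2); last by lia.
  by rewrite (_ : absz (l.1 + l.2) = (absz (l.1 - 1 + (l.2 - 1))).+2)//; lia.
rewrite (_ : (if _ is _.+2 then _ else _) = 0) ?mul0r//.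
move: h; case E: (absz (l.1 + l.2)) => [|[|m]]//; lia.
Qed.

Lemma norm1_neq0 (x : C) : `|x| = 1 -> x != 0.
Proof. by rewrite -normr_eq0 => ->; exact: oner_neq0. Qed.

(* The Cayley transform; circle_pt n runs through distinct points of the unit
   circle and tends to 1. *)
Definition circle_pt (n : nat) : C := (n%:R + 'i) / (n%:R - 'i).

Lemma circle_pt_den n : n%:R - 'i != 0 :> C.
Proof.
apply/negP => /eqP /(congr1 (fun x => 'Im x)).
rewrite raddfB/= Im_i (Creal_ImP _ _) ?realn// raddf0 => /eqP.
by rewrite sub0r oppr_eq0 oner_eq0.
Qed.

Lemma circle_pt_norm n : `|circle_pt n| = 1.
Proof.
rewrite /circle_pt normf_div -(norm_conjC (n%:R + 'i)) rmorphD/= conjCi conjC_nat.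
by rewrite divff// normr_eq0 circle_pt_den.
Qed.

Lemma circle_pt_inj : injective circle_pt.
Proof.
move=> m n /eqP; rewrite /circle_pt eqr_div ?circle_pt_den// => /eqP h.
have : 2 * 'i * (m%:R - n%:R) = 0 :> C.
  transitivity ((m%:R - 'i) * (n%:R + 'i) - (m%:R + 'i) * (n%:R - 'i) : C); first ring.
  by rewrite h; ring.
move=> /eqP; rewrite !mulf_eq0 pnatr_eq0/= (negPf (neq0Ci _))/= subr_eq0 eqr_nat.
by move=> /eqP.
Qed.

(** The difference is 2i / (n - i), and |n - i| >= n; the factor n stays on the left to include n =
    0. *)
Lemma circle_pt_near1 n : n%:R * `|circle_pt n - 1| <= 2.
Proof.
have -> : circle_pt n - 1 = 2 * 'i / (n%:R - 'i).
  by rewrite /circle_pt -[X in _ - X](divff (circle_pt_den n)) -mulrBl; congr (_ / _); ring.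
rewrite normf_div normrM normCi mulr1 normr_nat mulrA ler_pdivrMr; last first.
  by rewrite normr_gt0 circle_pt_den.
rewrite mulrC ler_pM2l//.
have [+ _] := leif_normC_Re_Creal (n%:R - 'i : C).
by rewrite raddfB/= Re_i subr0 (Creal_ReP _ _) ?realn// normr_nat.
Qed.

Lemma circle_pt_lt (e : C) n N : 0 < e -> 2 < N%:R * e -> (N <= n)%N ->
  `|circle_pt n - 1| < e.
Proof.
move=> e0 N2 Nn; have N0 : (0 < N)%N.
  by case: N N2 {Nn} => //; rewrite mul0r ltrn0.
rewrite -(ltr_pM2l (_ : 0 < n%:R)) ?ltr0n ?(leq_trans N0)//.
rewrite (le_lt_trans (circle_pt_near1 n))// (lt_le_trans N2)//.
by rewrite ler_pM2r// ler_nat.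
Qed.

(** Of the three distinct points with indices N, N + 1, N + 2 at most two are excluded. *)
Lemma circle_pt_avoid (a b : C) N :
  exists2 n, (N <= n)%N & (circle_pt n != a) && (circle_pt n != b).
Proof.
apply: contrapT => h.
have sub : {subset [seq circle_pt i | i <- iota N 3] <= [:: a; b]}.
  move=> _ /mapP[i + ->]; rewrite mem_iota => /andP[Ni _]; rewrite !inE.
  apply: contra_notT h; rewrite negb_or => h; by exists i.
have := uniq_leq_size _ sub.
by rewrite map_inj_uniq ?iota_uniq//; [move=> /(_ isT)|exact: circle_pt_inj].
Qed.

(** The Weyl denominator is (z1 - z2)(z1 - 1/z2)/z1, so for fixed z2 at most two values of z1 are
    singular. *)
Lemma so4_alt10_neq0 (z1 z2 : C) : z1 != 0 -> z2 != 0 ->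
  z1 != z2 -> z1 != z2^-1 -> so4_alt (1, 0) (z1, z2) != 0.
Proof.
move=> z10 z20 h1 h2; rewrite /so4_alt/= oppr0 !expr0z !expr1z !exprN1 !mulr1 !mul1r.
have -> : z1 + z1^-1 - z2 - z2^-1 = (z1 - z2) * (z1 - z2^-1) / z1.
  by field; rewrite z10 z20.
by rewrite !mulf_neq0 ?invr_eq0 ?subr_eq0.
Qed.

Lemma circle_pt_perturb (w1 w2 : C) N : w1 != 0 -> w2 != 0 ->
  exists2 n, (N <= n)%N & so4_alt (1, 0) (w1 * circle_pt n, w2) != 0.
Proof.
move=> w10 w20; have [n Nn /andP[ha hb]] := circle_pt_avoid (w2 / w1) (w2^-1 / w1) N.
exists n => //; apply: so4_alt10_neq0 => //.
- by rewrite mulf_neq0// norm1_neq0// circle_pt_norm.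
- by apply: contra ha => /eqP <-; rewrite mulrC mulKf.
- by apply: contra hb => /eqP <-; rewrite mulrC mulKf.
Qed.

End SO4Characters.

(** * Continuous extension of the Weyl quotient to the torus *)

Lemma continuous_exprn (K : numFieldType) (n : nat) :
  continuous (fun x : K => x ^+ n).
Proof.
elim: n => [|n ih] x; first exact: cst_continuous.
rewrite (_ : (fun x : K => x ^+ n.+1) = (fun x => x * x ^+ n)).
  by apply: (@continuousM K K id (fun x => x ^+ n) x); [move=> A|exact: ih].
by apply/funext => y; rewrite exprS.
Qed.

Lemma continuous_exprz (K : numFieldType) (a : K) (k : int) : a != 0 ->
  {for a, continuous (fun x : K => x ^ k)}.
Proof.
move=> a0; case: k => n; first exact: continuous_exprn.
apply: (@continuousV K K (fun x => x ^+ n.+1) a); last exact: continuous_exprn.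
by rewrite expf_neq0.
Qed.

Lemma continuous_so4_char (K : numFieldType) (l : int * int) (z : K * K) :
  z.1 != 0 -> z.2 != 0 ->
  {for z, continuous (so4_char l : K * K -> K)}.
Proof.
move=> z10 z20.
have c1 k : {for z, continuous (fun u : K * K => u.1 ^ k)}.
  apply: (@continuous_comp (K * K)%type K K fst (fun x : K => x ^ k)).
    exact: cvg_fst.
  exact: continuous_exprz.
have c2 k : {for z, continuous (fun u : K * K => u.2 ^ k)}.
  apply: (@continuous_comp (K * K)%type K K snd (fun x : K => x ^ k)).
    exact: cvg_snd.
  exact: continuous_exprz.
apply: (@cvg_big K) => [|i _]; first exact: add_continuous.
apply: (@cvg_big K) => [|j _]; first exact: add_continuous.
exact: (@continuousM K (K * K)%type _ _ z (c1 _) (c2 _)).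
Qed.

Lemma mulf_divK (F : fieldType) (a b : F) : a != 0 -> a * b / a = b.
Proof. by move=> a0; rewrite mulrC mulKf. Qed.

Lemma mulr_dist1 (K : numDomainType) (a b : K) : `|a| = 1 ->
  `|a - a * b| = `|b - 1|.
Proof. by move=> a1; rewrite -{1}(mulr1 a) -mulrBr normrM a1 mul1r distrC. Qed.

(** Radii of balls in [Cplx R] are themselves complex; a positive one has zero imaginary part, which
    leaves the Archimedean property of its real part. *)
Lemma complex_archi (R : realType) (e : Cplx R) : 0 < e ->
  exists N : nat, 2 < N%:R * e.
Proof.
case: e => a b; rewrite ltcE/= => /andP[/eqP -> a0].
exists (Num.truncn (2 / a)).+1.
have : 2 < (Num.truncn (2 / a)).+1%:R * a by rewrite -ltr_pdivrMr// truncnS_gt.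
by rewrite -ltcR rmorphM/= !rmorph_nat.
Qed.

Section SO4Topology.
Variable R : realType.
Implicit Types (l : int * int) (z w : Cplx R * Cplx R).

Lemma altSE l z : altS l z = so4_alt l z.
Proof. by []. Qed.

Lemma torus2_neq0 w : torus2 w -> w.1 != 0 /\ w.2 != 0.
Proof. by case=> h1 h2; split; exact: norm1_neq0. Qed.

(** Regular points accumulate at every point of the torus; were the filter in [chi] improper, its
    limit would not be determined. *)
Lemma torus2_reg_proper w : torus2 w -> ProperFilter (within (@torus2_reg R) (nbhs w)).
Proof.
move=> tw; have [w1 w2] := torus2_neq0 tw; case: tw => n1 n2.
apply: Build_ProperFilter_ex => P.
case=> -[A1 A2] /= [hA1 hA2] sub.
have A2w := @nbhs_singleton (Cplx R) w.2 A2 hA2.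
have [e /= e0 eA1] := (@nbhs_ballP _ (Cplx R) w.1 A1).1 hA1.
have [N hN] := complex_archi e0.
have [n Nn rn] := circle_pt_perturb N w1 w2.
have nu := circle_pt_norm (Cplx R) n.
exists (w.1 * circle_pt (Cplx R) n, w.2); apply: sub; last first.
  split; last by rewrite altSE.
  by split => //=; rewrite normrM n1 nu mulr1.
split => //=; apply: eA1; rewrite -ball_normE /=.
by rewrite mulr_dist1// (circle_pt_lt e0 hN).
Qed.


(** On the regular set the quotient agrees with a function continuous at w, whose value is therefore
    the limit. *)
Lemma chiE (l : Pplus) w : torus2 w -> chi l w = so4_char (val l) w.
Proof.
move=> tw; have [w1 w2] := torus2_neq0 tw.
have PF := torus2_reg_proper tw.
apply: cvg_lim; first exact: norm_hausdorff.
have h : so4_char (val l) z @[z --> within (@torus2_reg R) (nbhs w)] -->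
    so4_char (val l) w.
  by apply: cvg_within_filter; exact: continuous_so4_char.
apply: cvg_trans h; apply: near_eq_cvg.
near=> z.
have [tz z0] : torus2_reg z by near: z; exact: withinT.
have [z1 z2] := torus2_neq0 tz.
rewrite !altSE -so4_alt_char//; last exact: (valP l).
exact/esym/mulf_divK.
Unshelve. all: by end_near. Qed.

End SO4Topology.

(** * The range of the character on the torus *)

Section ChiImage.
Variable R : realType.
Implicit Types (u : Cplx R) (w : Cplx R * Cplx R).

Lemma so4_char_rho2 (F : fieldType) (z : F * F) : z.1 != 0 -> z.2 != 0 ->
  so4_char (1, 1) z = 1 + z.1 * z.2 + (z.1 * z.2)^-1.
Proof.
move=> z1 z2; rewrite /so4_char/= !big_ord_recl !big_ord0/= !addr0.
rewrite !expr1z !expr0z mulr1 invfM addrA [_ * _ + 1]addrC.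
by [].
Qed.

Lemma norm1_inv (C : numClosedFieldType) (u : C) : `|u| = 1 -> u^-1 = u^*.
Proof. by move=> u1; rewrite invC_norm u1 expr1n invr1 mul1r. Qed.

Lemma circleP (a b : R) : `|(a +i* b)%C : Cplx R| = 1 <-> a ^+ 2 + b ^+ 2 = 1.
Proof.
split => [|ab].
  rewrite normc_def => /complexI/= /(congr1 (fun x => x ^+ 2)).
  by rewrite expr1n sqr_sqrtr// addr_ge0// sqr_ge0.
by rewrite normc_def/= ab sqrtr1.
Qed.

Lemma chi_rho2E (a b : R) w : torus2 w -> w.1 * w.2 = (a +i* b)%C ->
  chi rho2 w = (1 + 2 * a)%:C%C.
Proof.
move=> tw E; have [w1 w2] := torus2_neq0 tw.
have u1 : `|(a +i* b)%C : Cplx R| = 1.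
  by case: tw => n1 n2; rewrite -E normrM n1 n2 mulr1.
rewrite chiE// so4_char_rho2// E norm1_inv//.
by apply/eqP; rewrite eq_complex/=; apply/andP; split; apply/eqP; ring.
Qed.

Lemma chi_rho2_image :
  [set chi rho2 w | w in @torus2 R] = [set (y%:C)%C | y in `[-1, 3 : R]].
Proof.
apply/seteqP; split => [_ [w tw <-]|_ [w yI <-]].
  case E : (w.1 * w.2) => [a b].
  have ab : a ^+ 2 + b ^+ 2 = 1.
    by apply/circleP; case: tw => n1 n2; rewrite -E normrM n1 n2 mulr1.
  exists (1 + 2 * a); last by rewrite (chi_rho2E tw E).
  have : `|a| <= 1.
    by rewrite -(@expr_le1 _ 2)// real_normK ?num_real// -[leRHS]ab lerDl sqr_ge0.
  by rewrite ler_norml /= in_itv/= => /andP[? ?]; apply/andP; split; lra.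
move: yI; rewrite /= in_itv/= => /andP[w1 w3].
(* The character is 1 + 2 Re u for u the product of the coordinates, so u must have real part a; b
   completes it to a point of the circle. *)
pose a := (w - 1) / 2; pose b := Num.sqrt (1 - a ^+ 2).
have a2 : a ^+ 2 <= 1.
  by rewrite -real_normK ?num_real// exprn_ile1// ler_norml /a; apply/andP; split; lra.
have ab : a ^+ 2 + b ^+ 2 = 1 by rewrite sqr_sqrtr ?subr_ge0// subrKC.
have tw : torus2 (((a +i* b)%C, 1) : Cplx R * Cplx R).
  by split; [apply/circleP|rewrite normr1].
exists ((a +i* b)%C, 1) => //.
rewrite (chi_rho2E tw (mulr1 _)); congr (_%:C)%C; rewrite /a; lra.
Qed.

End ChiImage.

(** * The graph of rho2 *)

Section AltIndependence.
Variable C : numClosedFieldType.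

Lemma poly_circle_eq0 (p : {poly C}) : (forall z, `|z| = 1 -> p.[z] = 0) -> p = 0.
Proof.
move=> p0; apply/eqP; apply: contraT => pn0.
have := max_poly_roots (rs := [seq circle_pt C i | i <- iota 0 (size p)]) pn0.
rewrite size_map size_iota ltnn; apply.
  by apply/allP => _ /mapP[i _ ->]; apply/rootP/p0/circle_pt_norm.
by rewrite map_inj_uniq ?iota_uniq//; exact: circle_pt_inj.
Qed.

(* The Kronecker substitution w = (z ^ N, z) turns the Laurent polynomials with
   exponents at most B < N / 2 into Laurent polynomials in one variable with
   the same coefficients; D makes the exponents nonnegative. *)
Lemma so4_alt_independent (T : eqType) (r : seq T) (l : T -> int * int) (c : T -> C) :
  uniq r -> injective l -> (forall x, `|(l x).2| < (l x).1) ->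
  (forall z : C * C, `|z.1| = 1 -> `|z.2| = 1 ->
    \sum_(x <- r) c x * so4_alt (l x) z = 0) ->
  {in r, forall x, c x = 0}.
Proof.
move=> ur injl ldom hz x0 x0r.
pose B : int := (\max_(x <- r) absz (l x).1)%N.
have lB x : x \in r -> (l x).1 <= B.
  move=> xr; have : (absz (l x).1 <= \max_(x <- r) absz (l x).1)%N.
    by apply: leq_bigmax_seq.
  by rewrite /B; lia.
(* With digits in [-B, B] the base 2B + 1 makes a pair of exponents a balanced two-digit expansion,
   which is unique. *)
pose N : int := 2 * B + 1; pose D : int := N * B + B.
have B0 : 0 <= B by [].
have N0 : 0 < N by rewrite /N; lia.
have e_ge0 a b : `|a| <= B -> `|b| <= B -> 0 <= D + N * a + b.
  move=> aB bB; have -> : D + N * a + b = N * (B + a) + (B + b) by rewrite /D; ring.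
  by apply: addr_ge0; [apply: mulr_ge0|]; lia.
have e_inj a b a' b' : `|b| <= B -> `|b'| <= B ->
    D + N * a + b = D + N * a' + b' -> a = a' /\ b = b'.
  move=> bB bB' h; have h' : N * (a - a') = b' - b by rewrite mulrBr; lia.
  have aa : a = a'.
    have [//|na] := eqVneq a a'.
    have : N <= `|N * (a - a')|.
      by rewrite normrM (gtr0_norm N0) ler_pMr// -gtz0_ge1 normr_gt0 subr_eq0.
    by rewrite h' /N; lia.
  by split => //; move: h'; rewrite aa subrr mulr0; lia.
pose e (ab : int * int) := absz (D + N * ab.1 + ab.2).
pose q (ab : int * int) : {poly C} :=
  'X^(e ab) + 'X^(e (- ab.1, - ab.2)) - 'X^(e (ab.2, ab.1)) - 'X^(e (- ab.2, - ab.1)).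
have bnd x : x \in r -> `|(l x).1| <= B /\ `|(l x).2| <= B.
  by move=> xr; have := lB x xr; have := ldom x; lia.
have q_eval x z : x \in r -> `|z| = 1 ->
    (q (l x)).[z] = so4_alt (l x) (z ^ N, z) * z ^ D.
  move=> xr z1; have z0 : z != 0 by exact: norm1_neq0.
  have [b1 b2] := bnd x xr.
  have E a b : `|a| <= B -> `|b| <= B -> z ^+ (e (a, b)) = (z ^ N) ^ a * z ^ b * z ^ D.
    move=> aB bB; rewrite exprz_exp -!expfzDr//.
    rewrite -[z ^+ _]/(z ^ (Posz (e (a, b)))); congr (_ ^ _).
    by rewrite /e gez0_abs ?e_ge0//=; ring.
  rewrite /q !hornerE /so4_alt/= {1}(surjective_pairing (l x)).
  by rewrite !E ?normrN//; ring.
have p0 : \sum_(x <- r) c x *: q (l x) = 0.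
  apply: poly_circle_eq0 => z z1; rewrite horner_sum.
  transitivity ((\sum_(x <- r) c x * so4_alt (l x) (z ^ N, z)) * z ^ D).
    rewrite mulr_suml; apply: eq_big_seq => x xr.
    by rewrite hornerZ q_eval// mulrA.
  by rewrite hz ?mul0r//=; case: (N) => k; rewrite ?normfV normrX z1 expr1n ?invr1.
have := congr1 (fun p : {poly C} => p`_(e (l x0))) p0.
rewrite coef0 coef_sum (bigD1_seq x0)//=.
have [b1 b2] := bnd x0 x0r.
have neq x ab : x \in r -> `|ab.1| <= B -> `|ab.2| <= B ->
    (e (l x0) == e ab) = (l x0 == ab).
  move=> xr a1 a2; apply/eqP/eqP => [|->//]; rewrite /e => h.
  have {}h : D + N * (l x0).1 + (l x0).2 = D + N * ab.1 + ab.2.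
    by rewrite -[LHS]gez0_abs ?e_ge0// h gez0_abs ?e_ge0.
  by case: (e_inj _ _ _ _ b2 a2 h); case: (l x0) ab {a1 a2 h} => [? ?] [? ?] /= -> ->.
(* Strict dominance separates [l x0] from the other three Weyl images of [l x], so only the leading
   monomial of [q (l x)] can contribute. *)
have qcoef x : x \in r -> (q (l x))`_(e (l x0)) = (l x0 == l x)%:R.
  move=> xr; have [c1 c2] := bnd x xr.
  rewrite /q !coefE !(neq x)// ?normrN//=.
  have h1 := ldom x; have h2 := ldom x0.
  rewrite (_ : (l x0 == (- (l x).1, - (l x).2)) = false); last first.
    by apply/eqP => h; move: h1 h2; rewrite h/=; lia.
  rewrite (_ : (l x0 == ((l x).2, (l x).1)) = false); last first.
    by apply/eqP => h; move: h1 h2; rewrite h/=; lia.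
  rewrite (_ : (l x0 == (- (l x).2, - (l x).1)) = false); last first.
    by apply/eqP => h; move: h1 h2; rewrite h/=; lia.
  by rewrite addr0 !subr0.
rewrite coefZ qcoef// eqxx mulr1 big1_seq ?addr0// => x /andP[xx0 xr].
by rewrite coefZ qcoef// (inj_eq injl) eq_sym (negPf xx0) mulr0.
Qed.

End AltIndependence.

Lemma Pplus_up_subproof (mu : Pplus) : `|(val mu + (1, 1)).2| <= (val mu + (1, 1)).1.
Proof. by case: mu => -[a b] /=; lia. Qed.

Definition Pplus_up (mu : Pplus) : Pplus := exist _ (val mu + (1, 1)) (Pplus_up_subproof mu).

Definition Pplus_down (mu : Pplus) : option Pplus := insub (val mu - (1, 1)).

Definition rho2_edges (mu nu : Pplus) : nat :=
  ((nu == Pplus_up mu)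
   + (0 < (val mu).1 + (val mu).2)%R * (nu == mu)
   + (Some nu == Pplus_down mu))%N.

Lemma big_delta (K : pzSemiRingType) (T : eqType) (r : seq T) (a : T) (F : T -> K) :
  uniq r -> a \in r -> \sum_(x <- r) (x == a)%:R * F x = F a.
Proof.
move=> ur ar; rewrite (bigD1_seq a)//= eqxx mul1r big1 ?addr0// => x /negPf ->.
by rewrite mul0r.
Qed.

(** [undup] avoids a proof that the vertices are distinct. *)
Definition rho2_nbrs (mu : Pplus) : seq Pplus :=
  undup [:: Pplus_up mu, mu & if Pplus_down mu is Some d then [:: d] else [::]].

Lemma rho2_edges_nbrs mu nu : nu \notin rho2_nbrs mu -> rho2_edges mu nu = 0%N.
Proof.
rewrite mem_undup !inE !negb_or /rho2_edges => /and3P[/negPf -> /negPf ->].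
rewrite muln0 !add0n; case: (Pplus_down mu) => [d|] nd; apply/eqP; rewrite eqb0//.
by apply: contra nd => /eqP[->]; rewrite inE.
Qed.

Lemma rho2_edges_finite mu : finite_set [set nu | rho2_edges mu nu != 0%N].
Proof.
apply: (@sub_finite_set _ _ [set` rho2_nbrs mu]); last exact: finite_seq.
by move=> nu /=; apply: contra_neqT; exact: rho2_edges_nbrs.
Qed.

Lemma fsbig_rho2_edges (K : nzSemiRingType) (F : Pplus -> K) (mu : Pplus) :
  \sum_(nu \in [set: Pplus]) (rho2_edges mu nu)%:R * F nu =
  F (Pplus_up mu) + (0 < (val mu).1 + (val mu).2)%R%:R * F mu
  + oapp F 0 (Pplus_down mu).
Proof.
rewrite (fsbigE (rho2_nbrs mu)) ?undup_uniq//; last first.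
  by move=> nu _ /rho2_edges_nbrs ->; rewrite mul0r.
rewrite big_mkcond/=; under eq_bigr do rewrite in_setT /rho2_edges !natrD !mulrDl.
rewrite !big_split/=; congr (_ + _ + _).
- by rewrite big_delta ?undup_uniq// mem_undup inE eqxx.
- under eq_bigr do rewrite natrM -mulrA.
  by rewrite -mulr_sumr big_delta ?undup_uniq// mem_undup !inE eqxx orbT.
case E : (Pplus_down mu) => [d|]/=; last by rewrite big1// => nu _; rewrite mul0r.
rewrite -(big_delta F (undup_uniq [:: Pplus_up mu, mu & [:: d]]) (a := d)).
  by rewrite /rho2_nbrs E.
by rewrite mem_undup !inE eqxx !orbT.
Qed.

Section Multiplicities.
Variable R : realType.

Lemma rho2_edges_multiplicity : is_multiplicity R rho2 rho2_edges.
Proof.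
move=> mu; split; first exact: rho2_edges_finite.
move=> w tw; have [w1 w2] := torus2_neq0 tw.
rewrite fsbig_rho2_edges !chiE// so4_char_rho2M//; last exact: (valP mu).
congr (_ + _); rewrite /Pplus_down; case: insubP => [d|] /= dP.
  by move=> vd; rewrite dP chiE//; congr (so4_char _ w).
by rewrite (negPf dP).
Qed.

(** Multiplied by [so4_alt (1, 0)], the difference of two expansions becomes a finite relation
    between alternating sums, and these are independent. *)
Lemma is_multiplicity_unique (r : Pplus) (m m' : Pplus -> Pplus -> nat) :
  is_multiplicity R r m -> is_multiplicity R r m' -> m = m'.
Proof.
move=> hm hm'; apply/funext => mu; apply/funext => nu0.
have [fm em] := hm mu; have [fm' em'] := hm' mu.
(* [nu0] is added because it may lie outside both supports. *)
have : finite_set ([set nu | m mu nu != 0%N] `|` [set nu | m' mu nu != 0%N] `|` [set nu0]).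
  by rewrite !finite_setU.
move=> /finite_fsetP[A hA].
have out (k : Pplus -> Pplus -> nat) (w : Cplx R * Cplx R) :
    [set nu | k mu nu != 0%N] `<=` [set` A] ->
    \sum_(nu \in [set: Pplus]) (k mu nu)%:R * chi nu w =
    \sum_(nu <- A) (k mu nu)%:R * chi nu w.
  move=> kA; rewrite (fsbigTE A)// => nu nuA.
  suff -> : k mu nu = 0%N by rewrite mul0r.
  by apply: contraNeq nuA => knu; exact: (kA nu).
have mA : [set nu | m mu nu != 0%N] `<=` [set` A].
  by rewrite -hA => x ?; left; left.
have mA' : [set nu | m' mu nu != 0%N] `<=` [set` A].
  by rewrite -hA => x ?; left; right.
have nu0A : nu0 \in enum_fset A.
  by have : [set` A] nu0 by rewrite -hA; right.
pose c (nu : Pplus) : Cplx R := (m mu nu)%:R - (m' mu nu)%:R.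
(* The shift by the Weyl vector (1, 0) makes dominant weights strictly dominant. *)
pose sh (nu : Pplus) : int * int := val nu + (1, 0).
suff /eqP : c nu0 = 0 by rewrite subr_eq0 eqr_nat => /eqP.
apply: (@so4_alt_independent _ _ A sh c (fset_uniq A)) nu0A.
- by move=> x y /addIr /val_inj.
- by case=> -[a b] /= h; rewrite /sh/=; lia.
move=> z z1 z2; have tz : torus2 z by [].
have [z10 z20] := torus2_neq0 tz.
transitivity (so4_alt (1, 0) z * \sum_(x <- A) c x * chi x z).
  rewrite mulr_sumr; apply: eq_bigr => x _.
  by rewrite chiE// mulrCA so4_alt_char//; exact: (valP x).
rewrite (_ : \sum_(x <- A) c x * chi x z = 0) ?mulr0//.
under eq_bigr do rewrite mulrBl.
by rewrite sumrB -!out// -em// -em'// subrr.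
Qed.

Lemma graphD42_rho2 : graphD42 R rho2 = rho2_edges.
Proof.
apply: (@is_multiplicity_unique rho2); last exact: rho2_edges_multiplicity.
by rewrite /graphD42; case: xgetP => [m _|/(_ rho2_edges)]// []; exact: rho2_edges_multiplicity.
Qed.

End Multiplicities.

(** * The density and its moments *)

Lemma continuous_1D2cos (R : realType) : continuous (fun x : R => 1 + 2 * cos x).
Proof.
move=> x; apply: cvgD; first exact: cvg_cst.
by apply: cvgM; [exact: cvg_cst|exact: continuous_cos].
Qed.

Section SpectralDensity.
Variable R : realType.
Local Notation mu := (@lebesgue_measure R).

(* Zero outside [-1, 3], because Num.sqrt vanishes on negative numbers and 0^-1 = 0. *)
Definition so4_pdf (y : R) : R :=
  1 / (2 * pi) * (Num.sqrt (3 - y) / Num.sqrt (y + 1)).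

Lemma so4_pdf_ge0 y : 0 <= so4_pdf y.
Proof.
by rewrite /so4_pdf mulr_ge0// divr_ge0// ?sqrtr_ge0// mulr_ge0// pi_ge0.
Qed.

Lemma so4_pdf_out y : y \notin `]-1, 3[ -> so4_pdf y = 0.
Proof.
rewrite in_itv/= negb_and -!leNgt => /orP[h|h].
  by rewrite /so4_pdf (_ : Num.sqrt (y + 1) = 0) ?invr0 ?mulr0//; apply: ler0_sqrtr; lra.
by rewrite /so4_pdf (_ : Num.sqrt (3 - y) = 0) ?mul0r ?mulr0//; apply: ler0_sqrtr; lra.
Qed.

Lemma continuous_so4_pdf y : -1 < y -> {for y, continuous so4_pdf}.
Proof.
move=> y1; apply: cvgM; first exact: cvg_cst.
apply: cvgM.
  apply: continuous_comp; last exact: sqrt_continuous.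
  by apply: cvgB; [exact: cvg_cst|exact: cvg_id].
apply: cvgV; first by rewrite gt_eqF// sqrtr_gt0; lra.
apply: continuous_comp; last exact: sqrt_continuous.
by apply: cvgD; [exact: cvg_id|exact: cvg_cst].
Qed.

Lemma measurable_so4_pdf : measurable_fun [set: measurableTypeR R] so4_pdf.
Proof.
rewrite (_ : so4_pdf = so4_pdf \_ `]-1, 3[).
  apply/(measurable_restrictT _ _).1 => //.
  apply: open_continuous_measurable_fun => // y.
  by rewrite inE/= in_itv/= => /andP[y1 _]; exact: continuous_so4_pdf.
apply/funext => y; rewrite patchE; case: ifPn => //.
by rewrite notin_setE/= => /negP h; apply: so4_pdf_out.
Qed.

Let c (x : R) : R := 1 + 2 * cos x.

Let der_c x : is_derive x (1 : R) c (- (2 * sin x)).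
Proof.
rewrite (_ : - (2 * sin x) = 0 + 2 *: (- sin x) ); last by rewrite add0r scalerN.
apply: is_deriveD.
Qed.

Let continuous_c : continuous c := @continuous_1D2cos R.

Let dc : (c^`())%classic = (fun x => - (2 * sin x)).
Proof. by apply/funext => x; rewrite derive1E; apply: derive_val. Qed.

Let continuous_dc : continuous (c^`())%classic.
Proof.
rewrite dc => x; apply: cvgN; apply: cvgM; first exact: cvg_cst.
exact: continuous_sin.
Qed.

Let decr_c (b : R) : b <= pi -> {in `[0, b] &, {homo c : x y /~ (x < y)%R}}.
Proof.
move=> bpi x y; rewrite !in_itv/= => /andP[x0 xb] /andP[y0 yb] yx.
by rewrite /c ltrD2l ltr_pM2l// ltr_cos// in_itv/= ?x0 ?y0 (le_trans _ bpi).
Qed.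

(** The Jacobian 2 sin x = 2 sqrt(1 - cos x) sqrt(1 + cos x) cancels the singular denominator. The
    point pi is excluded: there the left side is 0 by the convention on inverses, and the right side
    is 2/pi. *)
Lemma so4_pdf_cos x : 0 <= x < pi ->
  so4_pdf (1 + 2 * cos x) * (2 * sin x) = pi^-1 * (1 - cos x).
Proof.
move=> /andP[x0 xpi].
have c1 : -1 < cos x.
  by rewrite -cospi ltr_cos// in_itv/= ?lexx ?pi_ge0// x0 ltW.
have c2 : cos x <= 1 by exact: cos_le1.
have s0 : 0 <= sin x by rewrite sin_ge0_pi// x0 ltW.
have -> : sin x = Num.sqrt (1 - cos x) * Num.sqrt (1 + cos x).
  rewrite -sqrtrM; last by lra.
  rewrite -(_ : (sin x) ^+ 2 = (1 - cos x) * (1 + cos x)); last first.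
    by rewrite sin2cos2; ring.
  by rewrite sqrtr_sqr ger0_norm.
rewrite /so4_pdf.
have -> : 3 - (1 + 2 * cos x) = 2 * (1 - cos x) by ring.
have -> : 1 + 2 * cos x + 1 = 2 * (1 + cos x) by ring.
rewrite !sqrtrM//.
have t0 : Num.sqrt (2 : R) != 0 by rewrite gt_eqF// sqrtr_gt0.
have u0 : Num.sqrt (1 + cos x) != 0 by rewrite gt_eqF// sqrtr_gt0; lra.
have p0 : pi != 0 :> R by rewrite gt_eqF// pi_gt0.
rewrite -[1 - cos x in RHS]sqr_sqrtr; last by lra.
move: (@pi R) p0 => p p0; by field; rewrite t0 u0 p0.
Qed.

(** Truncation points increasing to pi: the substitution rule is applied to integrands continuous on
    a closed interval, and the density blows up at c pi = -1. The shift to n + 2 keeps [b_ 0]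
    positive. *)
Let b_ (n : nat) : R := pi * (1 - n.+2%:R^-1).

Let b_gt0 n : 0 < b_ n.
Proof. by rewrite mulr_gt0 ?pi_gt0// subr_gt0 invf_lt1// ltr1n. Qed.

Let b_ltpi n : b_ n < pi.
Proof. by rewrite gtr_pMr ?pi_gt0// gtrBl invr_gt0. Qed.

Let b_nd : {homo b_ : m n / (m <= n)%N >-> m <= n}.
Proof.
move=> m n mn; rewrite ler_pM2l ?pi_gt0// lerB// lef_pV2 ?posrE// ler_nat.
by rewrite !ltnS.
Qed.

Let b_sup x : x < pi -> exists n, x <= b_ n.
Proof.
move=> xpi; pose d := 1 - x / pi.
have d0 : 0 < d by rewrite subr_gt0 ltr_pdivrMr ?mul1r// pi_gt0.
exists (Num.truncn (d^-1)).
rewrite -ler_pdivrMl ?pi_gt0// [_ * x]mulrC.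
suff : (Num.truncn d^-1).+2%:R^-1 <= d by rewrite /d !lerBrDr [_ + x / pi]addrC.
rewrite -[leRHS]invrK lef_pV2 ?posrE ?invr_gt0//.
by rewrite ltW// (lt_trans (truncnS_gt _))// ltr_nat.
Qed.

(** Both sides are limits over truncated intervals by monotone convergence, whence the sign
    condition on h. *)
Lemma so4_pdf_subst (h : R -> R) : continuous h ->
  (forall y, -1 <= y <= 3 -> 0 <= h y) ->
  (\int[mu]_(y in `](-1)%R, 3%R]) (h y * so4_pdf y)%:E =
   \int[mu]_(x in `[0%R, pi[) (h (1 + 2 * cos x) * (pi^-1 * (1 - cos x)))%:E)%E.
Proof.
move=> ch h0.
have UL : `](-1)%R, 3%R]%classic = \bigcup_n `[c (b_ n), 3]%classic :> set R.
  apply/seteqP; split => [y|y [n _]]/=; rewrite !in_itv/=.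
    move=> /andP[y1 y3].
    have y' : -1 < (y - 1) / 2 <= 1 by apply/andP; split; lra.
    have [n xn] := b_sup (acos_ltpi y').
    exists n => //=; rewrite in_itv/= y3 andbT.
    have /acosK yE : (y - 1) / 2 \in `[-1, 1].
      by rewrite in_itv/=; case/andP: y' => ? ?; apply/andP; split; lra.
    suff : cos (b_ n) <= (y - 1) / 2 by rewrite /c; lra.
    rewrite -yE leNgt ltr_cos ?in_itv/= ?(ltW (b_gt0 n)) ?(ltW (b_ltpi n))//.
      by rewrite -leNgt.
    by move: y' => /andP[? ?]; rewrite acos_ge0 ?acos_lepi//; apply/andP; split => //; apply/ltW.
  move=> /andP[y1 ->]; rewrite andbT (lt_le_trans _ y1)//.
  suff : -1 < cos (b_ n) by rewrite /c; lra.
  by rewrite -cospi ltr_cos ?in_itv/= ?lexx ?pi_ge0 ?(ltW (b_gt0 n)) ?(ltW (b_ltpi n)).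
have UR : `[0, pi[%classic = \bigcup_n `[0, b_ n]%classic :> set R.
  apply/seteqP; split => [y|y [n _]]/=; rewrite !in_itv/=.
    by move=> /andP[y0 /b_sup[n yn]]; exists n => //=; rewrite in_itv/= y0.
  by move=> /andP[-> /le_lt_trans ->].
have cR : continuous (fun x => h (1 + 2 * cos x) * (pi^-1 * (1 - cos x))).
  move=> x; apply: cvgM.
    apply: continuous_comp; [exact: continuous_c|exact: ch].
  apply: cvgM; first exact: cvg_cst.
  by apply: cvgB; [exact: cvg_cst|exact: continuous_cos].
have cL y : -1 < y -> {for y, continuous (fun y => h y * so4_pdf y)}.
  by move=> y1; apply: cvgM; [exact: ch|exact: continuous_so4_pdf].
have c_gt n : -1 < c (b_ n).
  suff : -1 < cos (b_ n) by rewrite /c; lra.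
  by rewrite -cospi ltr_cos ?in_itv/= ?lexx ?pi_ge0 ?(ltW (b_gt0 n)) ?(ltW (b_ltpi n)).
have c0 : c 0 = 3 by rewrite /c cos0; ring.
have step n : (\int[mu]_(y in `[c (b_ n), 3%R]) (h y * so4_pdf y)%:E =
   \int[mu]_(x in `[0%R, b_ n]) (h (1 + 2 * cos x) * (pi^-1 * (1 - cos x)))%:E)%E.
  rewrite -[X in `[_, X]]c0.
  rewrite (@integration_by_substitution_decreasing _ c (fun y => h y * so4_pdf y) 0 (b_ n)).
  - apply: eq_integral => x; rewrite inE/= in_itv/= => /andP[x0 xb].
    congr (_%:E); rewrite !fctE dc opprK /= -mulrA so4_pdf_cos//.
    by rewrite x0 (le_lt_trans xb).
  - exact/ltW.
  - exact/decr_c/ltW.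
  - by move=> x _; exact: continuous_dc.
  - by apply/cvg_ex; eexists; exact/cvg_at_right_filter/continuous_dc.
  - by apply/cvg_ex; eexists; exact/cvg_at_left_filter/continuous_dc.
  - split.
    + by move=> x _; apply: ex_derive.
    + exact/cvg_at_right_filter/continuous_c.
    + exact/cvg_at_left_filter/continuous_c.
  - apply: continuous_in_subspaceT => y; rewrite inE/= in_itv/= => /andP[y1 _].
    by apply: cL; exact: lt_le_trans y1.
have mR : measurable_fun [set: measurableTypeR R]
    (fun x => (h (1 + 2 * cos x) * (pi^-1 * (1 - cos x)))%:E).
  by apply/measurable_EFinP; exact: continuous_measurable_fun.
have mL : measurable_fun [set: measurableTypeR R] (fun y => (h y * so4_pdf y)%:E).
  apply/measurable_EFinP; apply: measurable_funM => //; last exact: measurable_so4_pdf.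
  exact: continuous_measurable_fun.
rewrite UL UR.
have cvgL : (\int[mu]_(y in `[c (b_ n), 3%R]) (h y * so4_pdf y)%:E @[n --> \oo] -->
    \int[mu]_(y in \bigcup_n `[c (b_ n), 3%R]%classic) (h y * so4_pdf y)%:E)%E.
  apply: (@ge0_nondecreasing_set_cvg_integral _ (measurableTypeR R)) => //.
  - move=> m n mn; apply/subsetPset => y /=; rewrite !in_itv/= => /andP[+ ->].
    rewrite andbT; apply: le_trans; rewrite /c lerD2l ler_pM2l// leNgt.
    rewrite ltr_cos ?in_itv/= ?(ltW (b_gt0 _)) ?(ltW (b_ltpi _))//.
    by rewrite -leNgt b_nd.
  - by move=> n; exact: measurable_funS mL.
  - move=> n y /=; rewrite in_itv/= => /andP[y1 y3].
    by rewrite lee_fin mulr_ge0 ?so4_pdf_ge0// h0// y3 (le_trans (ltW (c_gt n))).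
have cvgR : (\int[mu]_(x in `[0%R, b_ n])
      (h (1 + 2 * cos x) * (pi^-1 * (1 - cos x)))%:E @[n --> \oo] -->
    \int[mu]_(x in \bigcup_n `[0%R, b_ n]%classic)
      (h (1 + 2 * cos x) * (pi^-1 * (1 - cos x)))%:E)%E.
  apply: (@ge0_nondecreasing_set_cvg_integral _ (measurableTypeR R)) => //.
  - move=> m n mn; apply/subsetPset => y /=; rewrite !in_itv/= => /andP[-> /le_trans].
    by apply; exact: b_nd.
  - by move=> n; exact: measurable_funS mR.
  - move=> n x _; rewrite lee_fin mulr_ge0//.
      by apply: h0; have := cos_le1 x; have := cos_geN1 x => ? ?; apply/andP; split; lra.
    by rewrite mulr_ge0 ?invr_ge0 ?pi_ge0// subr_ge0 cos_le1.
rewrite -(cvg_lim _ cvgL)// -(cvg_lim _ cvgR)//.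
by congr (lim _); rewrite (funext step).
Qed.

End SpectralDensity.

(* The number of walks of length k from j to 0 on the half-line with a loop at
   every vertex except 0. *)
Fixpoint walks (k j : nat) : nat :=
  if k is k'.+1 then
    (walks k' j.+1 + (if j is i.+1 then walks k' j + walks k' i else 0))%N
  else (j == 0)%N.

(** * Walk counts as cosine integrals *)

Section Moments.
Variable R : realType.
Local Notation mu := (@lebesgue_measure R).

(** These are the characters of SO(3) times 1 - cos x. At j = -1 the formula would give -e_0, which
    cancels the loop at 0; hence the special form of [e_rec0]. *)
Let e (j : nat) (x : R) : R := cos (j%:R * x) - cos (j.+1%:R * x).

Let e0 x : e 0 x = 1 - cos x.
Proof. by rewrite /e mul0r cos0 mul1r. Qed.

Let cos_rec j (x : R) :
  2 * cos x * cos (j.+1%:R * x) = cos (j.+2%:R * x) + cos (j%:R * x).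
Proof.
have -> : j.+2%:R * x = j.+1%:R * x + x by rewrite -[in LHS]natr1; ring.
have -> : j%:R * x = j.+1%:R * x - x by rewrite -[in RHS]natr1; ring.
by rewrite cosD cosB; ring.
Qed.

Let e_rec0 x : (1 + 2 * cos x) * e 0 x = e 1 x.
Proof.
have := cos_rec 0 x; rewrite /e mul1r mul0r cos0 => h.
by rewrite -(addrK 1 (cos (2 * x))) -h; ring.
Qed.

Let e_recS j x : (1 + 2 * cos x) * e j.+1 x = e j.+2 x + e j.+1 x + e j x.
Proof.
have h1 := cos_rec j x; have h2 := cos_rec j.+1 x.
rewrite /e mulrDl mul1r mulrBr h1 h2; ring.
Qed.

Lemma continuous_cosM (a : R) : continuous (fun x => cos (a * x)).
Proof.
move=> x; apply: continuous_comp; last exact: continuous_cos.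
by apply: cvgM; [exact: cvg_cst|exact: cvg_id].
Qed.

Let continuous_e j : continuous (e j).
Proof. by move=> x; apply: cvgB; exact: continuous_cosM. Qed.

Lemma continuous_expr_comp (f : R -> R) k : continuous f ->
  continuous (fun x => f x ^+ k).
Proof.
move=> cf x; apply: (@continuous_comp _ _ _ f (fun y => y ^+ k)); first exact: cf.
exact: exprn_continuous.
Qed.

Lemma continuous_itv_integrable (f : R -> R) (a b : R) : continuous f ->
  mu.-integrable `[a, b] (EFin \o f).
Proof.
move=> cf; apply: continuous_compact_integrable; first exact: segment_compact.
exact: continuous_subspaceT.
Qed.

Let sin_natr_pi j : sin (j%:R * pi) = 0 :> R.
Proof.
elim: j => [|j ih]; first by rewrite mul0r sin0.
by rewrite -natr1 mulrDl mul1r sinDpi ih oppr0.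
Qed.

Let is_derive_sinM (a x : R) : a != 0 ->
  is_derive x (1 : R) (fun x => a^-1 * sin (a * x)) (cos (a * x)).
Proof.
move=> a0.
have h : is_derive x (1 : R) (fun x : R => a * x) (a * 1).
  exact: (@is_deriveZ _ _ _ id a).
have := @is_deriveZ _ _ _ (sin \o (fun x => a * x)) a^-1 x (1 : R) _
  (@is_derive1_comp _ sin (fun x => a * x) x _ _ (is_derive_sin _) h).
by rewrite mulr1 /GRing.scale/= mulrCA mulVf// mulr1; exact.
Qed.

Lemma Rintegral_cosM j :
  \int[mu]_(x in `[0, pi]) cos (j%:R * x) = if j == 0%N then pi else 0.
Proof.
rewrite /Rintegral; case: j => [|j] /=.
  under eq_integral do rewrite mul0r cos0.
  by rewrite integral_cst//= lebesgue_measure_itv/= lte_fin pi_gt0 sube0 mul1e.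
have d x : is_derive x (1 : R) (fun x => j.+1%:R^-1 * sin (j.+1%:R * x))
    (cos (j.+1%:R * x)) by apply: is_derive_sinM; rewrite pnatr_eq0.
have cF : continuous (fun x : R => j.+1%:R^-1 * sin (j.+1%:R * x)).
  by move=> x; exact/differentiable_continuous/derivable1_diffP.
rewrite (@continuous_FTC2 _ _ (fun x => j.+1%:R^-1 * sin (j.+1%:R * x)) 0 pi).
- by rewrite sin_natr_pi !mulr0 sin0 mulr0 subee.
- exact: pi_gt0.
- exact/continuous_subspaceT/continuous_cosM.
- split => [x _| |].
  + exact: ex_derive.
  + exact/cvg_at_right_filter/cF.
  + exact/cvg_at_left_filter/cF.
- by move=> x _; rewrite derive1E; exact: derive_val.
Qed.

Let cvM k j : continuous (fun x : R => (1 + 2 * cos x) ^+ k * e j x).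
Proof.
move=> x; apply: cvgM; last exact: continuous_e.
exact: (continuous_expr_comp (@continuous_1D2cos R)).
Qed.

Let J k j := \int[mu]_(x in `[0, pi]) ((1 + 2 * cos x) ^+ k * e j x).

(** Induction on k: multiplication by 1 + 2 cos x acts on the functions [e j] as one step acts on
    [walks], and for k = 0 only the constant cos (0 x) has a nonzero integral. *)
Lemma Rintegral_walks k j :
  \int[mu]_(x in `[0, pi])
    ((1 + 2 * cos x) ^+ k * (cos (j%:R * x) - cos (j.+1%:R * x))) =
  pi * (walks k j)%:R.
Proof.
rewrite -[LHS]/(J k j).
elim: k j => [|k ih] j.
  rewrite /J; under eq_Rintegral do rewrite expr0 mul1r.
  rewrite RintegralB//;
    [|apply: continuous_itv_integrable; exact: continuous_cosM..].
  by rewrite !Rintegral_cosM/= subr0; case: j => [|j]; rewrite /= ?mulr1 ?mulr0.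
case: j => [|j].
  by rewrite /= addn0 -ih; apply: eq_Rintegral => x _; rewrite exprSr -mulrA e_rec0.
rewrite /= !natrD !mulrDr -!ih /J.
rewrite -RintegralD//; [|exact: continuous_itv_integrable..].
rewrite -RintegralD//.
- by apply: eq_Rintegral => x _; rewrite exprSr -mulrA e_recS; ring.
- exact: continuous_itv_integrable.
- apply: (@continuous_itv_integrable (fun x => (1 + 2 * cos x) ^+ k * e j.+1 x +
    (1 + 2 * cos x) ^+ k * e j x) 0 pi) => x.
  by apply: cvgD; exact: cvM.
Qed.

End Moments.

(** * Compactly supported measures and moments *)

Section Determinacy.
Variable R : realType.

Lemma bernoulli_ge (x : R) n : -1 <= x -> 1 + n%:R * x <= (1 + x) ^+ n.
Proof.
move=> x1; elim: n => [|n ih]; first by rewrite mul0r addr0 expr0.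
rewrite exprS; apply: (@le_trans _ _ ((1 + x) * (1 + n%:R * x))); last first.
  by apply: ler_wpM2l => //; lra.
rewrite -natr1 -subr_ge0.
have -> : (1 + x) * (1 + n%:R * x) - (1 + (n%:R + 1) * x) = n%:R * x ^+ 2 by ring.
by rewrite mulr_ge0// sqr_ge0.
Qed.

(** Write r = s^2: Bernoulli at 1/s bounds n s^n, and the remaining factor s^n tends to 0. *)
Lemma cvg_natr_geometric (r : R) : 0 <= r < 1 -> (n%:R * r ^+ n) @[n --> \oo] --> 0.
Proof.
move=> /andP[]; rewrite le_eqVlt => /predU1P[<- _|r0 r1].
  apply/cvgrPdist_le => /= e e0; near=> n; rewrite sub0r normrN.
  have n0 : (0 < n)%N by near: n; exists 1%N.
  by rewrite expr0n eqn0Ngt n0/= mulr0 normr0 ltW.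
pose s := Num.sqrt r.
have s0 : 0 < s by rewrite sqrtr_gt0.
have s1 : s < 1 by rewrite -[1]sqrtr1 ltr_sqrt.
have d0 : 0 < s^-1 - 1 by rewrite subr_gt0 invf_gt1.
have key n : n%:R * s ^+ n <= (s^-1 - 1)^-1.
  rewrite -[leRHS]div1r ler_pdivlMr//.
  have := @bernoulli_ge (s^-1 - 1) n; rewrite subrKC exprVn => h.
  have {}h : 1 + n%:R * (s^-1 - 1) <= (s ^+ n)^-1 by apply: h; lra.
  have sn0 : 0 < s ^+ n by exact: exprn_gt0.
  move: h; rewrite -(ler_pM2r sn0) mulVf ?gt_eqF// => h.
  by rewrite (le_trans _ h)// mulrAC ler_pM2r// lerDr.
have h : ((s^-1 - 1)^-1 * s ^+ n) @[n --> \oo] --> 0.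
  rewrite -[X in _ --> X](mulr0 (s^-1 - 1)^-1); apply: cvgM; first exact: cvg_cst.
  by apply: cvg_expr; rewrite gtr0_norm.
suff nr : \forall n \near \oo,
    0 <= n%:R * r ^+ n <= (s^-1 - 1)^-1 * s ^+ n by exact: (squeeze_cvgr nr (cvg_cst _) h).
apply: nearW => n; apply/andP; split; first by rewrite mulr_ge0// exprn_ge0// ltW.
have -> : r ^+ n = s ^+ n * s ^+ n by rewrite -exprMn -expr2 sqr_sqrtr// ltW.
by rewrite mulrA ler_wpM2r// exprn_ge0// ltW.
Unshelve. all: by end_near. Qed.

(* The approximants of Brosowski and Deutsch; the factor n in the exponent makes
   the limit 0 also at the threshold u = 1/2. *)
Lemma cvg_threshold (u : R) : 0 <= u <= 1 ->
  ((1 - u ^+ n) ^+ (n * 2 ^ n)) @[n --> \oo] --> ((u < 2^-1)%R%:R : R).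
Proof.
move=> /andP[u0 u1].
have v01 n : 0 <= u ^+ n <= 1 by rewrite exprn_ge0//= exprn_ile1.
have [uh|uh] := ltP u (2^-1).
  (* Below 1/2, Bernoulli gives the lower bound 1 - n (2u)^n. *)
  have h : (1 - n%:R * (2 * u) ^+ n) @[n --> \oo] --> (1 : R).
    rewrite -[X in _ --> X]subr0; apply: cvgB; first exact: cvg_cst.
    by apply: cvg_natr_geometric; lra.
  suff nr : \forall n \near \oo, 1 - n%:R * (2 * u) ^+ n <=
      (1 - u ^+ n) ^+ (n * 2 ^ n) <= 1 by exact: (squeeze_cvgr nr h (cvg_cst _)).
  apply: nearW => n; case/andP: (v01 n) => v0 v1.
  rewrite exprn_ile1 ?subr_ge0 ?gerBl// andbT.
  have := @bernoulli_ge (- u ^+ n) (n * 2 ^ n); rewrite lerN2 => /(_ v1).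
  by apply: le_trans; rewrite natrM natrX exprMn mulrN mulrA.
(* From 1/2 on, the product with (1 + u^n)^N is at most 1, while (1 + u^n)^N >= 1 + n (2u)^n >= n +
   1. *)
suff nr : \forall n \near \oo, 0 <= (1 - u ^+ n) ^+ (n * 2 ^ n) <= harmonic n.
  exact: (squeeze_cvgr nr (cvg_cst _) cvg_harmonic).
apply: nearW => n; case/andP: (v01 n) => v0 v1.
rewrite exprn_ge0 ?subr_ge0//=.
set N := (n * 2 ^ n)%N.
have a : (1 - u ^+ n) ^+ N * (1 + u ^+ n) ^+ N <= 1.
  rewrite -exprMn exprn_ile1//.
    by rewrite mulr_ge0// ?subr_ge0// addr_ge0.
  have -> : (1 - u ^+ n) * (1 + u ^+ n) = 1 - (u ^+ n) ^+ 2 by ring.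
  by rewrite gerBl sqr_ge0.
have b : n.+1%:R <= (1 + u ^+ n) ^+ N.
  apply: le_trans (@bernoulli_ge (u ^+ n) N _); last lra.
  rewrite -natr1 addrC lerD2l natrM natrX -mulrA -exprMn ler_peMr//.
  by rewrite exprn_ege1//; lra.
rewrite -div1r ler_pdivlMr// (le_trans _ a)// ler_wpM2l// exprn_ge0// subr_ge0//.
Qed.

(** Stated for all large M' so that two measures can share one interval. *)
Lemma compact_support_itv (P : probability (measurableTypeR R) R) (K : set R) :
  compact K -> P (~` K) = 0%E ->
  exists M : R, forall M' : R, M <= M' -> P (~` `[- M', M']) = 0%E.
Proof.
move=> cK PK.
have mK : measurable (K : set (measurableTypeR R)) by exact: compact_measurable.
have [M [_ KM]] := compact_bounded cK.
exists (M + 1) => M' MM'.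
apply: (@subset_measure0 _ _ _ P _ (~` K)) => //.
- by apply: measurableC.
- by apply: measurableC.
apply: subsetC => x Kx; rewrite /= in_itv/= -ler_norml.
by apply: (KM M') => //; lra.
Qed.

Variable P : probability (measurableTypeR R) R.

Lemma continuous_prob_itv_integrable (f : R -> R) (a b : R) : continuous f ->
  P.-integrable `[a, b] (EFin \o f).
Proof.
move=> cf; apply: measurable_bounded_integrable => //.
- by rewrite (le_lt_trans (probability_le1 _ _)) ?ltry.
- by apply: measurable_funTS; exact: continuous_measurable_fun.
have /compact_bounded[M [_ mrt]] :=
  continuous_compact (continuous_subspaceT cf) (@segment_compact R a b).
exists M; split; first exact: num_real.
by move=> x Mx y aby; apply: mrt => //; exists y.
Qed.

Lemma integrable_support (f : R -> R) (M : R) : P (~` `[- M, M]) = 0%E ->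
  continuous f -> P.-integrable setT (EFin \o f).
Proof.
move=> PM cf.
apply/(@negligible_integrable _ _ _ P _ (~` `[- M, M]) _ _ _ _ PM) => //.
- exact: measurableC.
- by apply/measurable_EFinP; exact: continuous_measurable_fun.
by rewrite setTD setCK; exact: continuous_prob_itv_integrable.
Qed.

Lemma Rintegral_support (f : R -> R) (M : R) : P (~` `[- M, M]) = 0%E ->
  continuous f -> \int[P]_x f x = \int[P]_(x in `[- M, M]) f x.
Proof.
move=> PM cf; rewrite /Rintegral.
rewrite (@negligible_integral _ _ _ P setT (~` `[- M, M]))//.
- by rewrite setTD setCK.
- exact: measurableC.
- exact: integrable_support PM cf.
Qed.

End Determinacy.

Section MomentUniqueness.
Variable R : realType.
Implicit Types P Q : probability (measurableTypeR R) R.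

Lemma Rintegral_poly P (M : R) (p : {poly R}) : P (~` `[- M, M]) = 0%E ->
  \int[P]_x p.[x] = \sum_(i < size p) p`_i * \int[P]_x (x ^+ i).
Proof.
move=> PM; under eq_Rintegral do rewrite horner_coef.
elim: (size p) => [|n ih].
  rewrite big_ord0; under eq_Rintegral do rewrite big_ord0.
  by rewrite Rintegral_cst// mul0r.
have cX i : continuous (fun x : R => x ^+ i) by move=> x; exact: exprn_continuous.
have cZ i : continuous (fun x : R => p`_i * x ^+ i).
  by move=> x; apply: cvgM; [exact: cvg_cst|exact: cX].
rewrite big_ord_recr/= -ih; under [LHS]eq_Rintegral do rewrite big_ord_recr/=.
rewrite RintegralD//.
- by congr (_ + _); rewrite RintegralZl//; exact: integrable_support PM (cX n).
- apply: (@integrable_support _ P (fun x => \sum_(i < n) p`_i * x ^+ i) M PM) => x.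
  by apply: cvg_big => [|i _]; [exact: add_continuous|exact: cZ].
- exact: integrable_support PM (cZ n).
Qed.

(** The affine map sends [-M, M] into [0, 1] and a to the threshold 1/2, so on that interval the
    approximants tend to the indicator of x < a, dominated by 1. *)
Lemma cvg_ray_prob P (D M a : R) : P (~` `[- M, M]) = 0%E -> 0 <= M ->
  M + `|a| <= D -> 0 < D ->
  (\int[P]_x ((1 - (2^-1 + (x - a) / (2 * D)) ^+ n) ^+ (n * 2 ^ n)))%:E
    @[n --> \oo] --> P `]-oo, a[%classic.
Proof.
move=> PM M0 MD D0.
pose u (x : R) := 2^-1 + (x - a) / (2 * D).
pose q n (x : R) := (1 - u x ^+ n) ^+ (n * 2 ^ n).
have cu : continuous u.
  move=> x; apply: cvgD; first exact: cvg_cst.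
  apply: cvgM; last exact: cvg_cst.
  by apply: cvgB; [exact: cvg_id|exact: cvg_cst].
have cq n : continuous (q n).
  apply: continuous_expr_comp => x; apply: cvgB; first exact: cvg_cst.
  exact: (@continuous_expr_comp _ u n cu x).
have u01 x : - M <= x <= M -> 0 <= u x <= 1.
  rewrite -ler_norml => xM.
  have : `|x - a| <= D by rewrite (le_trans (ler_normB _ _))// (le_trans _ MD)// lerD2r.
  rewrite ler_norml => /andP[h1 h2].
  suff : `|(x - a) / (2 * D)| <= 2^-1.
    by rewrite ler_norml /u => /andP[h3 h4]; apply/andP; split; lra.
  rewrite normrM normfV (gtr0_norm (_ : 0 < 2 * D)) ?mulr_gt0//.
  by rewrite ler_pdivrMr ?mulr_gt0// mulKf// ler_norml h1.
have uh x : (u x < 2^-1) = (x < a).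
  by rewrite /u -[X in _ < X]addr0 ltrD2l pmulr_llt0 ?subr_lt0// invr_gt0 mulr_gt0.
have -> : P `]-oo, a[%classic =
    (\int[P]_(x in `[(- M)%R, M]) (\1_(`]-oo, a[%classic : set R) x)%:E)%E.
  rewrite integral_indic// setIC.
  have /= := @measureDI _ _ _ P `]-oo, a[%classic `[- M, M]%classic.
  move=> ->//; rewrite setIC -[RHS]adde0 addeC; congr (_ + _)%E.
  rewrite setDE; apply: (@subset_measure0 _ _ _ P _ (~` `[- M, M]%classic)) => //.
  by apply: measurableI => //; exact: measurableC.
  exact: measurableC.
have -> : (fun n => (\int[P]_x q n x)%:E) =
    (fun n => (\int[P]_(x in `[(- M)%R, M]) (q n x)%:E)%E).
  apply/funext => n; rewrite (Rintegral_support PM)//.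
  by rewrite fineK//; apply: integrable_fin_num => //; exact: continuous_prob_itv_integrable.
have [||||||] := @dominated_convergence _ _ _ P `[- M, M]%classic _
  (fun n x => (q n x)%:E) (fun x => (\1_(`]-oo, a[%classic : set R) x)%:E) (cst 1%E).
- by [].
- move=> n; apply/measurable_EFinP; apply: measurable_funTS.
  exact: continuous_measurable_fun.
- apply/measurable_EFinP; apply: measurable_funTS; exact: measurable_indic.
- apply: aeW => x /=; rewrite in_itv/= => xM.
  apply/cvg_EFin; first by apply: nearW.
  have := cvg_threshold (u01 _ xM).
  by rewrite uh indicE mem_setE/= in_itv/=.
- exact: finite_measure_integrable_cst.
- apply: aeW => x n /=; rewrite in_itv/= => xM; rewrite lee_fin.
  have /andP[u0 u1] := u01 _ xM.
  have ? : u x ^+ n <= 1 by exact: exprn_ile1.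
  by rewrite ger0_norm ?exprn_ile1 ?exprn_ge0 ?subr_ge0 ?gerBl ?exprn_ge0.
- by move=> _ _.
Qed.

(** Open rays form a pi-system generating the Borel sets, and their measures are limits of integrals
    of polynomials, which the moments determine. *)
Lemma probability_moments_unique P Q (K L : set R) :
  compact K -> P (~` K) = 0%E -> compact L -> Q (~` L) = 0%E ->
  (forall k : nat, \int[P]_x (x ^+ k) = \int[Q]_x (x ^+ k)) ->
  forall A : set (measurableTypeR R), measurable A -> P A = Q A.
Proof.
move=> cK PK cL QL PQ.
have [M1 hP] := compact_support_itv cK PK.
have [M2 hQ] := compact_support_itv cL QL.
pose M := Num.max 0 (Num.max M1 M2).
have {}hP : P (~` `[- M, M]) = 0%E by apply: hP; rewrite !le_max lexx ?orbT.
have {}hQ : Q (~` `[- M, M]) = 0%E by apply: hQ; rewrite !le_max lexx ?orbT.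
have M0 : 0 <= M by rewrite le_max lexx.
pose G : set (set (measurableTypeR R)) := [set A | exists x, A = `]-oo, x[%classic].
apply: (@measure_unique _ R (measurableTypeR R) G (fun n => `]-oo, n%:R[%classic)).
- exact: RGenInftyO.measurableE.
- move=> _ _ [x ->] [y ->]; exists (Num.min x y).
  by apply/seteqP; split => z /=; rewrite !in_itv/= lt_min => /andP.
- by move=> n; exists n%:R.
- apply/seteqP; split => // x _; exists (Num.truncn `|x|).+1 => //=.
  by rewrite in_itv/= (le_lt_trans (ler_norm _))// truncnS_gt.
- move=> _ [a ->].
  (* The summand 1 keeps D positive when M and a vanish. *)
  pose D := M + `|a| + 1.
  have D0 : 0 < D by rewrite ltr_wpDl ?addr_ge0.
  have MD : M + `|a| <= D by rewrite lerDl.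
  have cP := cvg_ray_prob hP M0 MD D0.
  have cQ := cvg_ray_prob hQ M0 MD D0.
  pose p n : {poly R} := (1 - (2^-1%:P + (2 * D)^-1 *: ('X - a%:P)) ^+ n) ^+ (n * 2 ^ n).
  have pE n x : (1 - (2^-1 + (x - a) / (2 * D)) ^+ n) ^+ (n * 2 ^ n) = (p n).[x].
    by rewrite /p !hornerE/= mulrC.
  rewrite -[LHS](cvg_lim _ cP)// -[RHS](cvg_lim _ cQ)//.
  congr (lim _); rewrite (_ : (fun n => _) = (fun n => (\int[Q]_x
    (1 - (2^-1 + (x - a) / (2 * D)) ^+ n) ^+ (n * 2 ^ n))%:E))//.
  apply/funext => n; congr (_%:E).
  under eq_Rintegral do rewrite pE.
  under [RHS]eq_Rintegral do rewrite pE.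
  rewrite (Rintegral_poly _ hP) (Rintegral_poly _ hQ).
  by apply: eq_bigr => i _; rewrite PQ.
- by move=> n; rewrite (le_lt_trans (probability_le1 _ _)) ?ltry.
Qed.

End MomentUniqueness.

(** * The spectral measure *)

Definition so4_prob (R : realType) : set (measurableTypeR R) -> \bar R :=
  fun A => (\int[@lebesgue_measure R]_(y in A) (so4_pdf y)%:E)%E.

Section So4Prob.
Variable R : realType.
Local Notation mu := (@lebesgue_measure R).
Local Notation so4_prob := (@so4_prob R).

Let mso4_pdf (A : set (measurableTypeR R)) :
  measurable_fun A (fun y => (so4_pdf y)%:E).
Proof. by apply/measurable_EFinP/measurable_funTS; exact: measurable_so4_pdf. Qed.

(** Brings the weight 1 - cos x into the shape of [Rintegral_walks] at j = 0. *)
Let pihalf (f : R -> R) : continuous f ->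
  \int[mu]_(x in `[0, pi]) (f x * (pi^-1 * (1 - cos x))) =
  pi^-1 * \int[mu]_(x in `[0, pi]) (f x * (cos (0%:R * x) - cos (1%:R * x))).
Proof.
move=> cf; rewrite -RintegralZl//.
  by apply: eq_Rintegral => x _; rewrite mul0r cos0 mul1r; ring.
apply: (@continuous_itv_integrable _
  (fun x : R => f x * (cos (0%:R * x) - cos (1%:R * x)))) => x.
by apply: cvgM; [exact: cf|apply: cvgB; exact: continuous_cosM].
Qed.

Lemma integral_mul_so4_pdf (h : R -> R) : continuous h ->
  (forall y, -1 <= y <= 3 -> 0 <= h y) ->
  (\int[mu]_y (h y * so4_pdf y)%:E =
   (pi^-1 * \int[mu]_(x in `[0%R, pi])
     (h (1 + 2 * cos x) * (cos (0%:R * x) - cos (1%:R * x))))%:E)%E.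
Proof.
move=> ch h0.
have chc : continuous (fun x : R => h (1 + 2 * cos x)).
  move=> x; apply: (@continuous_comp _ _ _ (fun x : R => 1 + 2 * cos x) h); last exact: ch.
  exact: continuous_1D2cos.
have cf : continuous (fun x : R => h (1 + 2 * cos x) * (pi^-1 * (1 - cos x))).
  move=> x; apply: cvgM; first exact: chc.
  by apply: cvgM; [exact: cvg_cst|apply: cvgB; [exact: cvg_cst|exact: continuous_cos]].
transitivity (\int[mu]_(y in `](-1)%R, 3%R]) (h y * so4_pdf y)%:E)%E.
  rewrite [RHS]integral_mkcond; apply: eq_integral => y _.
  rewrite patchE; case: ifPn => //; rewrite notin_setE/= => /negP yI.
  rewrite so4_pdf_out ?mulr0//; apply: contra yI; rewrite !in_itv/= => /andP[-> ?].
  exact: ltW.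
rewrite so4_pdf_subst// integral_itv_bndo_bndc; last first.
  apply/measurable_EFinP; apply: measurable_funTS; exact: continuous_measurable_fun.
rewrite -pihalf// /Rintegral. rewrite fineK//.
by apply: integrable_fin_num => //; exact: continuous_itv_integrable.
Qed.

Lemma integral_so4_pdf : (\int[mu]_y (so4_pdf y)%:E = 1)%E.
Proof.
transitivity (\int[mu]_y (cst 1 y * so4_pdf y)%:E)%E.
  by apply: eq_integral => y _; rewrite mul1r.
rewrite integral_mul_so4_pdf//; last by move=> x; exact: cvg_cst.
have h : \int[mu]_(x in `[0, pi]) (1 * (cos (0%:R * x) - cos (1%:R * x))) = pi.
  by rewrite -[RHS]mulr1 -(Rintegral_walks R 0 0); apply: eq_Rintegral => x _; rewrite expr0.
by rewrite h mulVf// gt_eqF// pi_gt0.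
Qed.

Lemma integrable_so4_pdf : mu.-integrable setT (EFin \o @so4_pdf R).
Proof.
apply/integrableP; split; first exact: mso4_pdf.
under eq_integral do rewrite /= ger0_norm ?so4_pdf_ge0//.
by rewrite integral_so4_pdf ltry.
Qed.

Let so4_prob0 : so4_prob set0 = 0%E.
Proof. by rewrite /so4_prob integral_set0. Qed.

Let so4_prob_ge0 A : (0 <= so4_prob A)%E.
Proof. by apply: integral_ge0 => y _; rewrite lee_fin so4_pdf_ge0. Qed.

Let so4_prob_sigma_additive : semi_sigma_additive so4_prob.
Proof.
move=> /= A mA tA mUA; rewrite /so4_prob/= integral_bigcup//=; last first.
  by apply: (integrableS _ _ (subsetT _)) => //; exact: integrable_so4_pdf.
apply: is_cvg_ereal_nneg_natsum_cond => n _ _.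
by apply: integral_ge0 => y _; rewrite lee_fin so4_pdf_ge0.
Qed.

HB.instance Definition _ := isMeasure.Build _ (measurableTypeR R) R
  so4_prob so4_prob0 so4_prob_ge0 so4_prob_sigma_additive.

Let so4_prob_setT : so4_prob setT = 1%E.
Proof. exact: integral_so4_pdf. Qed.

HB.instance Definition _ :=
  @Measure_isProbability.Build _ _ R so4_prob so4_prob_setT.

Lemma so4_prob_dominates : so4_prob `<< mu.
Proof.
apply/null_content_dominatesP => A mA muA0; exact: null_set_integral.
Qed.

Lemma so4_prob_support : so4_prob (~` `[-1, 3]) = 0%E.
Proof.
apply: integral0_eq => y /= /negP yI; rewrite so4_pdf_out//.
by apply: contra yI; rewrite !in_itv/= => /andP[? ?]; apply/andP; split; exact: ltW.
Qed.

(** The density is almost everywhere the Radon-Nikodym derivative, as the two have equal integrals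
    over every measurable set. *)
Lemma integral_so4_prob (f : measurableTypeR R -> \bar R) :
  so4_prob.-integrable setT f ->
  (\int[so4_prob]_y f y = \int[mu]_y (f y * (so4_pdf y)%:E))%E.
Proof.
move=> intf; have mf := measurable_int _ intf.
rewrite -(Radon_Nikodym_change_of_variables so4_prob_dominates)//=.
apply: ae_eq_integral => //.
- apply: emeasurable_funM => //; apply: (measurable_int mu).
  by apply: Radon_Nikodym_integrable; exact: so4_prob_dominates.
- exact: emeasurable_funM.
- apply: ae_eqe_mul2l => /=.
  rewrite Radon_NikodymE//=; first exact: so4_prob_dominates.
  move=> dom; case: cid => /= g [g1 g2 g3].
  apply: integral_ae_eq => //=.
  by move=> E _ mE; rewrite -g3.
Qed.

Lemma so4_prob_moments k : \int[so4_prob]_y (y ^+ k) = (walks k 0)%:R.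
Proof.
have ck : continuous (fun y : R => y ^+ k) by move=> y; exact: exprn_continuous.
have S0 : so4_prob (~` `[- 3, 3]) = 0%E.
  apply: (@subset_measure0 _ _ _ so4_prob _ (~` `[-1, 3]%classic)) => //.
  - exact: measurableC.
  - exact: measurableC.
  - apply: subsetC => y /=; rewrite !in_itv/= => /andP[? ->]; rewrite andbT; lra.
  - exact: so4_prob_support.
rewrite /Rintegral integral_so4_prob; last exact: integrable_support S0 ck.
(* For odd k, y^k is negative on part of [-1, 3]; adding 1 makes it nonnegative there, and the total
   mass 1 is subtracted at the end. *)
have h1 y : -1 <= y <= 3 -> 0 <= y ^+ k + 1 :> R.
  move=> /andP[y1 y3]; have [y0|y0] := leP 0 y; first by rewrite addr_ge0// exprn_ge0.
  have : `|y ^+ k| <= 1 by rewrite normrX exprn_ile1// ler_norml; lra.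
  by rewrite ler_norml; lra.
have ck1 : continuous (fun y : R => y ^+ k + 1).
  by move=> y; apply: cvgD; [exact: ck|exact: cvg_cst].
have E1 := integral_mul_so4_pdf ck1 h1.
have int1 : mu.-integrable setT (fun y => ((y ^+ k + 1) * so4_pdf y)%:E).
  apply/integrableP; split.
    apply/measurable_EFinP; apply: measurable_funM; last exact: measurable_so4_pdf.
    exact: continuous_measurable_fun.
  rewrite [ltLHS](_ : _ = \int[mu]_y ((y ^+ k + 1) * so4_pdf y)%:E)%E; last first.
    apply: eq_integral => y _; rewrite /= ger0_norm//.
    have [yI|/so4_pdf_out ->] := boolP (y \in `]-1, 3[); last by rewrite mulr0.
    rewrite mulr_ge0 ?so4_pdf_ge0// h1//; move: yI; rewrite in_itv/=.
    by move=> /andP[? ?]; apply/andP; split; exact: ltW.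
  by rewrite E1 ltry.
transitivity (fine (\int[mu]_y (((y ^+ k + 1) * so4_pdf y)%:E - (so4_pdf y)%:E))%E).
  by congr fine; apply: eq_integral => y _; rewrite -EFinM -EFinB; congr (_%:E); ring.
rewrite integralB//; last exact: integrable_so4_pdf.
rewrite E1 integral_so4_pdf /=.
have cc (i : nat) : continuous (fun x : R => (1 + 2 * cos x) ^+ i *
    (cos (0%:R * x) - cos (1%:R * x))).
  move=> x; apply: cvgM; last by apply: cvgB; exact: continuous_cosM.
  exact: (continuous_expr_comp (@continuous_1D2cos R)).
(* The added 1 becomes a zeroth power, so that [Rintegral_walks] evaluates it as well. *)
transitivity (pi^-1 * (\int[mu]_(x in `[0, pi]) ((1 + 2 * cos x) ^+ k *
    (cos (0%:R * x) - cos (1%:R * x))) +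
   \int[mu]_(x in `[0, pi]) ((1 + 2 * cos x) ^+ 0 *
    (cos (0%:R * x) - cos (1%:R * x)))) - 1).
  congr (_ * _ - _); rewrite -RintegralD//.
  - by apply: eq_Rintegral => x _; rewrite expr0; ring.
  - exact: continuous_itv_integrable.
  - exact: continuous_itv_integrable.
rewrite !Rintegral_walks -mulrDr mulKf ?addrK//.
by rewrite gt_eqF// pi_gt0.
Qed.

End So4Prob.

(** * Moments of the adjacency operator at the distinguished vertex *)

Section Ell2FiniteSupport.
Variables (R : realType) (V : choiceType).

Lemma square_summable_finite (f : V -> Cplx R) (S : set V) : finite_set S ->
  (forall v, ~ S v -> f v = 0) -> square_summable f.
Proof.
move=> fS f0; rewrite /square_summable.
rewrite [X in (X < _)%E](_ : _ = (\esum_(v in S)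
    (complex.Re (f v) ^+ 2 + complex.Im (f v) ^+ 2)%:E)%E).
  rewrite esum_fset//; first by rewrite fsbig_finite// sumEFin ltry.
  by move=> v _; rewrite lee_fin addr_ge0// sqr_ge0.
rewrite [RHS]esum_mkcond; apply: eq_esum => v _; case: ifPn => // /negP.
by rewrite inE => /f0 ->; rewrite expr0n addr0.
Qed.

(** The partial sums are constant as soon as the finite set contains v. *)
Lemma ell2_inner_delta (f : ell2 R V) (v : V) : ell2_inner f (ell2_delta R v) = f v.
Proof.
have PF := @summability.totally_filter V.
rewrite /ell2_inner /summability.sum; apply: cvg_lim; first exact: norm_hausdorff.
apply: (@cvg_near_cst _ (Cplx R) _ _ summability.totally).
exists [fset v]%fset => // B /fsubsetP/(_ v (fset11 v)) vB.
rewrite /summability.partial_sum -(big_seq_fsetE _ _ xpredT (fun u => f u * (u == v)%:R^*))/=.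
rewrite (bigD1_seq v)//= eqxx conjC1 mulr1 big1 ?addr0// => u /negPf ->.
by rewrite conjC0 mulr0.
Qed.

Lemma adjacency_opE (m : V -> V -> nat) (f : ell2 R V) :
  square_summable (adjacency_fun m f) -> adjacency_op m f =1 adjacency_fun m f.
Proof. by move=> h v; rewrite /adjacency_op; case: pselect. Qed.

End Ell2FiniteSupport.

Section Walks.
Variable R : realType.

(** The candidate for the k-th iterate: only diagonal vertices are joined to (0, 0) by walks. *)
Let g (k : nat) (mu : Pplus) : Cplx R :=
  ((val mu).1 == (val mu).2)%:R * (walks k (absz (val mu).1))%:R.

Lemma walks_eq0 k j : (k < j)%N -> walks k j = 0%N.
Proof.
elim: k j => [|k ih] [|j]//= kj; rewrite !ih//; lia.
Qed.

Lemma Pplus_diag_subproof (j : nat) : `|(j%:Z, j%:Z).2| <= (j%:Z, j%:Z).1.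
Proof. by []. Qed.

(** The support is finite because a walk of length k cannot reach 0 from j > k. This keeps
    [adjacency_op] out of its zero branch along the iteration. *)
Let g_square_summable k : square_summable (g k).
Proof.
apply: (@square_summable_finite _ _ _
  ((fun j : nat => exist _ (j%:Z, j%:Z) (Pplus_diag_subproof j) : Pplus) @` `I_k.+1)).
  exact/finite_image/finite_II.
move=> mu Smu; rewrite /g; case: eqP => [e|_]; last by rewrite mul0r.
rewrite walks_eq0 ?mulr0// ltnNge; apply/negP => h; apply: Smu.
exists (absz (val mu).1) => //=; apply: val_inj => /=.
by case: mu e {h} => -[a b] /= ab e; congr pair; lia.
Qed.

Let g_step k mu : adjacency_fun rho2_edges (g k) mu = g k.+1 mu.
Proof.
rewrite /adjacency_fun fsbig_rho2_edges.
have [e|ne] := eqVneq (val mu).1 (val mu).2; last first.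
  (* Edges preserve the difference of the coordinates, so off the diagonal every term vanishes. *)
  rewrite /g /= (inj_eq (addIr _)) (negPf ne) !mul0r mulr0 !add0r.
  rewrite /Pplus_down; case: insubP => [d _ vd|_]//=; rewrite /g vd/=.
  by rewrite (inj_eq (addIr _)) (negPf ne) mul0r.
have [j ej] : exists j : nat, val mu = (j%:Z, j%:Z).
  by case: mu e => -[a b] /= ab e; exists (absz a); congr pair; lia.
rewrite /Pplus_down; case: insubP => [d|]; rewrite ej /=.
  move=> hd vd; case: j ej hd vd => [|j] ej; first by lia.
  move=> _ vd.
  rewrite /g /= vd ej /= !eqxx !mul1r.
  by rewrite addn1 subn1 !natrD addrA.
(* At the origin there is neither a loop nor a lower neighbour. *)
case: j ej => [|j] ej; last by lia.
by move=> _; rewrite /g /= ej /= mul0r !addr0 addn0.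
Qed.

Lemma iter_adjacency k :
  iter k (adjacency_op rho2_edges) (ell2_delta R star) =1 g k.
Proof.
elim: k => [|k ih] mu /=.
  rewrite /g /= -natrM; congr (_%:R); rewrite mulnb; congr nat_of_bool.
  case: mu => -[a b] /= ab; apply/eqP/andP => [[-> ->]//|[/eqP e /eqP a0]].
  by apply: val_inj => /=; congr pair; lia.
have E : adjacency_fun rho2_edges (iter k (adjacency_op rho2_edges) (ell2_delta R star))
    = g k.+1.
  by apply/funext => v; rewrite (funext ih) g_step.
by rewrite adjacency_opE E//; exact: g_square_summable.
Qed.

Lemma adjacency_moment k :
  ell2_inner (iter k (adjacency_op rho2_edges) (ell2_delta R star)) (ell2_delta R star)
  = ((walks k 0)%:R : R)%:C%C.
Proof. by rewrite ell2_inner_delta iter_adjacency /g/= mul1r rmorph_nat. Qed.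

End Walks.

(** Both existence and uniqueness are reduced to this real moment problem. *)
Lemma is_spectral_measure_moments (R : realType)
    (nu : probability (measurableTypeR R) R) :
  is_spectral_measure (graphD42 R rho2) star nu <->
  (exists K : set R, compact K /\ nu (~` K) = 0%E) /\
  forall k : nat, \int[nu]_t (t ^+ k) = (walks k 0)%:R.
Proof.
rewrite /is_spectral_measure graphD42_rho2; split => -[hK h]; split => // k.
  by apply/esym/complexI; rewrite -h adjacency_moment.
by rewrite h adjacency_moment.
Qed.

Theorem theorem8p10 (R : realType) :
  [set chi rho2 w | w in @torus2 R] = [set (y%:C)%C | y in `[-1, 3 : R]]
  /\ (exists nu : probability (measurableTypeR R) R,
        is_spectral_measure (graphD42 R rho2) star nu)
  /\ forall nu : probability (measurableTypeR R) R,
       is_spectral_measure (graphD42 R rho2) star nu ->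
       forall A : set (measurableTypeR R), measurable A ->
         nu A = (\int[@lebesgue_measure R]_(y in A `&` `[(-1 : R)%R, (3 : R)%R])
                   (1 / (2 * pi) * (Num.sqrt (3 - y) / Num.sqrt (y + 1)))%R%:E)%E.
Proof.
split; first exact: chi_rho2_image.
split.
  exists (@so4_prob R); apply/is_spectral_measure_moments; split.
    by exists `[-1, 3]%classic; split; [exact: segment_compact|exact: so4_prob_support].
  exact: so4_prob_moments.
move=> nu /is_spectral_measure_moments[[K [cK nuK]] nu_moments] A mA.
rewrite (@probability_moments_unique R nu (@so4_prob R) K `[-1, 3]%classic)//.
(* The density vanishes outside (-1, 3), so cutting the domain down to [-1, 3] does not change the
   integral. *)
- rewrite integral_mkcondr; apply: eq_integral => y _.
  rewrite patchE; case: ifPn => //; rewrite notin_setE/= => /negP yI.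
  rewrite so4_pdf_out//; apply: contra yI; rewrite !in_itv/= => /andP[? ?].
  by apply/andP; split; exact: ltW.
- exact: segment_compact.
- exact: so4_prob_support.
- by move=> k; rewrite nu_moments so4_prob_moments.
Qed.
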